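(* Let $X_1,\ldots,X_n$ be real-valued independent random variables whose densities are bounded by $K$ almost everywhere. Let $a_1,\ldots,a_n$ be real numbers with $\sum_{j=1}^n a_j^2=1$. Then the density of $\sum_{j=1}^n a_jX_j$ is bounded by $\sqrt{2}\,K$ almost everywhere. Moreover, this estimate is optimal: the density value $\sqrt{2}\,K$ is achieved by the sum $\frac{1}{\sqrt{2}}(X_1+X_2)$, where $X_1,X_2$ are independent random variables uniformly distributed in $[-\frac{1}{2K},\frac{1}{2K}]$.
   Context: Densities are with respect to Lebesgue measure on $\mathbb{R}$. *)

(* Defs.v *)
From HB Require Import structures.
From mathcomp Require Import all_boot all_order all_algebra.
From mathcomp Require Import all_classical all_reals all_analysis.
From mathcomp Require Import measurable_realfun.

Set Implicit Arguments.
Unset Strict Implicit.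
Unset Printing Implicit Defensive.

Import Order.TTheory GRing.Theory Num.Theory.
Import numFieldNormedType.Exports.

Local Open Scope classical_set_scope.
Local Open Scope ring_scope.

Section RandomVariables.
Context {d : measure_display} {T : measurableType d} {R : realType}.
Variable P : probability T R.

Definition mutually_independent (I : finType) (X : I -> {RV P >-> R}) : Prop :=
  forall (J : {set I}) (A : I -> set R), (forall i, measurable (A i)) ->
    P (\bigcap_(i in [set` J]) (X i @^-1` A i)) =
    (\prod_(i in J) P (X i @^-1` A i))%E.

Definition is_density (X : {RV P >-> R}) (f : R -> R) : Prop :=
  [/\ measurable_fun setT f,
      forall x, 0 <= f x &
      forall A : set R, measurable A ->
        distribution P X A = (\int[lebesgue_measure]_(x in A) (f x)%:E)%E].

(* A density is only determined up to a Lebesgue-null set, so the bound is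
   required of every version. *)
Definition density_bounded_by (X : {RV P >-> R}) (M : R) : Prop :=
  (exists f, is_density X f) /\
  forall f, is_density X f -> {ae lebesgue_measure, forall x, f x <= M}.

Definition uniformly_distributed (X : {RV P >-> R}) (a b : R) : Prop :=
  exists ab : a < b, forall A : set R, measurable A ->
    distribution P X A = uniform_prob ab A.

End RandomVariables.

Arguments mutually_independent {d T R} P {I} X.
Arguments is_density {d T R} P X f.
Arguments density_bounded_by {d T R} P X M.
Arguments uniformly_distributed {d T R} P X a b.

(* Main.v *)
Require Import Defs.
From HB Require Import structures.
From mathcomp Require Import all_boot all_order all_algebra.
From mathcomp Require Import all_classical all_reals all_analysis.
From mathcomp Require Import measurable_realfun.
From mathcomp Require Import ring lra.

(** Let [f x = P (x + S \in J)] for an interval [J] of length [c], where [S] is a partial sum of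
    the [Y_j = a_j X_j]. Adding [Y_j] replaces [f] by an average of its translates: the law of
    [Y_j] is the image of the uniform law on [(0, b_j)], [b_j = |a_j| / K], by a quantile function
    [q], and the density bound says exactly that [q y - q x >= y - x] for [x <= y]. Integrals of
    [f] along maps [e] of an interval of length [l] with this same expansion property are bounded
    by a function [Q l]; by foliating a rectangle by L-shaped paths, on which [e - q] is again
    expanding, one sees that [Q] evolves under the averaging as if all variables were uniform
    (a form of Rogozin's inequality). For uniform variables Fourier inversion gives
    [Q l = 2/pi c \int_0^oo l sinc(l t) sinc(c t) \prod_j sinc(b_j t) dt].

    If [a_j^2 <= 1/2] for all [j], the weighted AM-GM inequality and Ball's inequality
    [\int_0^oo |sinc|^p <= (pi / 2) sqrt(2 / p)], [p >= 2], give [Q l <= sqrt 2 K c l], whence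
    [P (S \in A) <= sqrt 2 K |A|] for all [A]. If some [a_j^2 > 1/2], the density of [a_j X_j]
    alone is bounded by [K / |a_j| <= sqrt 2 K], and adding the other variables preserves this.

    Ball's inequality is proved for [2 <= p <= 4] by expanding [(1 - (1 - sinc^2))^((p-2)/2)] and
    using the exact moments [\int sinc^2], [\int sinc^4], [\int sinc^6], and for [p >= 4] by
    comparing [sinc t] with [exp (- t^2 / 6)]. *)


Set Implicit Arguments.
Unset Strict Implicit.
Unset Printing Implicit Defensive.

Import Order.TTheory GRing.Theory Num.Theory.
Import numFieldNormedType.Exports.

Local Open Scope classical_set_scope.
Local Open Scope ring_scope.

(** * Affine changes of variables *)

Section affine.
Context {R : realType}.
Local Notation mu := (@lebesgue_measure R).

(** The estimates of [sinc] speak about uniform variables only, so the crux is to reach arbitrary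
    bounded densities. An induction on the number of variables must survive a change of the extremal
    configuration at each step. Quantifying a profile over all expanding maps achieves this: the
    maps produced by the L-shaped paths differ from the one started with, but the induction
    hypothesis applies to them as well. Fourier inversion is not invoked. The integral formula for
    [Q] is verified as the solution of a recursion, by product formulas for sines at the start and
    at each step. The two factors in [l] and [c] make the integral absolutely convergent before any
    variable has been added. The threshold 1/2 for [a_j^2] comes from the exponent [p = a_j^-2]
    produced by AM-GM, since Ball's inequality is used for [p >= 2]. At [p = 2] it is an equality,
    so a lossy comparison cannot work nearby; this is why exact moments are used for small [p]. The
    Gaussian comparison gains a factor sqrt (3 / pi), and this small room has to absorb the tail. *)

Lemma measurable_affine (a c : R) :
  measurable_fun setT ((fun x => a * x + c) : measurableTypeR R -> measurableTypeR R).
Proof. by apply: measurable_funD => //; exact: measurable_funM. Qed.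

Lemma preimage_affine_itv (a c x y : R) : a != 0 ->
  mu ((fun t => a * t + c) @^-1` `]x, y]) = ((`|a|^-1)%:E * mu `]x, y])%E.
Proof.
move=> a0; have [agt|alt|/eqP] := ltgtP a 0; last by rewrite (negbTE a0).
- have -> : (fun t => a * t + c) @^-1` `]x, y] = `[((y - c) / a), ((x - c) / a)[%classic.
    apply/seteqP; split => t /=; rewrite !in_itv/= ler_ndivrMr// ltr_ndivlMr// => /andP[]; lra.
  rewrite !lebesgue_measure_itv/= !lte_fin ltr_ndivrMr// divfK// ltrD2r.
  case: ifPn => _; last by rewrite mule0.
  rewrite -!EFinD -EFinM ltr0_norm//; congr EFin; field.
  by rewrite ?oppr_eq0 a0.
- have -> : (fun t => a * t + c) @^-1` `]x, y] = `]((x - c) / a), ((y - c) / a)]%classic.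
    apply/seteqP; split => t /=; rewrite !in_itv/= ler_pdivlMr// ltr_pdivrMr// => /andP[]; lra.
  rewrite !lebesgue_measure_itv/= !lte_fin ltr_pdivrMr// divfK// ltrD2r.
  case: ifPn => _; last by rewrite mule0.
  rewrite -!EFinD -EFinM gtr0_norm//; congr EFin; field.
  by rewrite a0.
Qed.

(** The image measure multiplied by the absolute value of [a] agrees with Lebesgue measure on
    half-open intervals, which determine it. *)
Lemma lebesgue_measure_affine (a c : R) (A : set R) : a != 0 -> measurable A ->
  mu ((fun t => a * t + c) @^-1` A) = ((`|a|^-1)%:E * mu A)%E.
Proof.
move=> a0 mA.
have a0' : 0 <= `|a| by [].
suff -> : mu A = mscale (NngNum a0') (pushforward mu
   ((fun t => a * t + c) : measurableTypeR R -> measurableTypeR R)) A.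
- exact: measurable_affine.
- move=> mphi; rewrite /mscale/= /pushforward muleA -EFinM mulVf ?mul1e//.
  by rewrite normr_eq0.
move=> mphi; apply: lebesgue_measure_unique => //= _ [[x y] _ <-].
rewrite /mscale/= /pushforward preimage_affine_itv// muleA -EFinM mulfV ?mul1e//.
by rewrite normr_eq0.
Qed.

Lemma ge0_integral_affine (a c : R) (D : set R) (f : R -> \bar R) :
  a != 0 -> measurable D -> measurable_fun D f ->
  (forall x, D x -> 0 <= f x)%E ->
  (\int[mu]_(y in D) f y =
   `|a|%:E * \int[mu]_(x in (fun t => a * t + c)%R @^-1` D) f (a * x + c)%R)%E.
Proof.
move=> a0 mD mf f0.
have a0' : 0 <= `|a| by [].
have f0' : {in D, forall y, 0 <= f y}%E by move=> y /[!inE]; exact: f0.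
have mphi := measurable_affine a c.
have := ge0_integral_pushforward mphi mu mD mf f0'.
rewrite /comp => <-.
pose m := measure_function_pushforward__canonical__measure_function_Measure mu mphi.
rewrite -(ge0_integral_mscale m mD (NngNum a0') mf)//.
apply: eq_measure_integral => A mA _ /=.
rewrite /mscale/= /pushforward lebesgue_measure_affine// muleA -EFinM mulfV ?mul1e//.
by rewrite normr_eq0.
Qed.
End affine.

(** * Elementary integrals on the half-line *)

Section derive_rules.
Context {R : realType}.
Implicit Types (f g : R -> R) (x a b c : R).

Lemma deriv_id x : is_derive x 1 (fun t : R => t) 1.
Proof. exact: is_derive_id. Qed.
Lemma deriv_cst x c : is_derive x 1 (fun=> c) 0.
Proof. exact: is_derive_cst. Qed.
Lemma deriv_add f g x a b : is_derive x 1 f a -> is_derive x 1 g b ->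
  is_derive x 1 (fun t => f t + g t) (a + b).
Proof. by move=> hf hg; exact: is_deriveD. Qed.
Lemma deriv_opp f x a : is_derive x 1 f a -> is_derive x 1 (fun t => - f t) (- a).
Proof. by move=> hf; exact: is_deriveN. Qed.
Lemma deriv_mul f g x a b : is_derive x 1 f a -> is_derive x 1 g b ->
  is_derive x 1 (fun t => f t * g t) (a * g x + f x * b).
Proof.
move=> hf hg; apply: is_derive_eq (is_deriveM hf hg) _.
by rewrite addrC [a * _]mulrC.
Qed.
Lemma deriv_exp f (n : nat) x a : is_derive x 1 f a ->
  is_derive x 1 (fun t => f t ^+ n) (n%:R * f x ^+ n.-1 * a).
Proof.
move=> hf; have -> : (fun t => f t ^+ n) = f ^+ n by rewrite exprfctE.
exact: is_derive_eq (is_deriveX n hf) _.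
Qed.
Lemma deriv_comp f g x a b : is_derive (g x) 1 f a -> is_derive x 1 g b ->
  is_derive x 1 (fun t => f (g t)) (a * b).
Proof. by move=> hf hg; exact: is_derive1_comp. Qed.
End derive_rules.

(* Solves [is_derive x 1 f ?d] for an expression [f], whatever the shape expected for the
   derivative; [der_eq] leaves the equation between the derivative found and the one expected. *)
Ltac der := lazymatch goal with
| |- is_derive _ _ (fun t => t) _ => notypeclasses refine (deriv_id _)
| |- is_derive _ _ (fun t => @?f t + @?g t) _ => notypeclasses refine (@deriv_add _ f g _ _ _ _ _); der
| |- is_derive _ _ (fun t => - @?f t) _ => notypeclasses refine (@deriv_opp _ f _ _ _); der
| |- is_derive _ _ (fun t => @?f t * @?g t) _ => notypeclasses refine (@deriv_mul _ f g _ _ _ _ _); der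
| |- is_derive _ _ (fun t => @?f t ^+ ?n) _ => notypeclasses refine (@deriv_exp _ f n _ _ _); der
| |- is_derive _ _ (fun t => expR (@?f t)) _ => notypeclasses refine (@deriv_comp _ expR f _ _ _ (is_derive_expR _) _); der
| |- is_derive _ _ (fun t => sin (@?f t)) _ => notypeclasses refine (@deriv_comp _ sin f _ _ _ (is_derive_sin _) _); der
| |- is_derive _ _ (fun t => cos (@?f t)) _ => notypeclasses refine (@deriv_comp _ cos f _ _ _ (is_derive_cos _) _); der
| |- is_derive _ _ (fun t => atan (@?f t)) _ => notypeclasses refine (@deriv_comp _ atan f _ _ _ (is_derive1_atan _) _); der
| |- _ => first [eassumption | notypeclasses refine (deriv_cst _ _) | idtac]
end.

Ltac der_eq := notypeclasses refine (is_derive_eq _ _); [der|].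

Section laplace.
Context {R : realType}.
Local Notation mu := (@lebesgue_measure R).

Lemma cvg_powexp (n : nat) (t : R) : 0 < t -> x ^+ n * expR (- t * x) @[x --> +oo%R] --> (0 : R).
Proof.
move=> t0.
(* A single term of the exponential series, of degree [n.+1] in [t * x], bounds the function by
   [C / x]. *)
pose C := (n.+1)`!%:R / t ^+ n.+1.
have C0 : 0 <= C by rewrite divr_ge0// exprn_ge0// ltW.
apply: (@squeeze_cvgr _ _ _ _ (cst 0) (fun x => C / x)).
- near=> x.
  have x0 : 0 < x by near: x; exact: nbhs_pinfty_gt.
  rewrite mulr_ge0 ?expR_ge0 ?exprn_ge0 ?(ltW x0)//=.
  rewrite mulNr expRN ler_pdivrMr ?expR_gt0//.
  have := @expR_ge1Dxn _ (t * x) n (mulr_ge0 (ltW t0) (ltW x0)).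
  move=> h; have : (t * x) ^+ n.+1 / (n.+1)`!%:R <= expR (t * x) by lra.
  move=> /(ler_wpM2l C0); rewrite [C / x * _]mulrAC ler_pdivlMr// => /(le_trans _); apply.
  rewrite /C exprMn [x ^+ n.+1]exprSr.
  have ? : t ^+ n.+1 != 0 by rewrite expf_neq0// gt_eqF.
  have ? : (n.+1)`!%:R != 0 :> R by rewrite pnatr_eq0 -lt0n fact_gt0.
  by rewrite le_eqVlt; apply/orP; left; apply/eqP; field; apply/andP.
- exact: cvg_cst.
- rewrite -(mulr0 C); apply: cvgMr => //.
  apply/gtr0_cvgV0; last exact: cvg_id.
  by near=> x; near: x; exact: nbhs_pinfty_gt.
Unshelve. all: by end_near. Qed.

Lemma ge0_FTC0y (f F : R -> R) (l : R) : (forall x, 0 <= x -> 0 <= f x) ->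
  continuous f -> (forall x : R, is_derive x 1 F (f x)) -> F x @[x --> +oo%R] --> l ->
  (\int[mu]_(x in `]0%R, +oo[) (f x)%:E = (l - F 0)%:E)%E.
Proof.
move=> f0 cf dF Fl.
rewrite integral_itv_obnd_cbnd; last first.
  by apply/measurable_EFinP; apply: measurable_funTS; exact: continuous_measurable_fun.
rewrite (@ge0_continuous_FTC2y _ f F 0 l)//.
- exact: continuous_subspaceT.
- apply: cvg_at_right_filter.
  have dF0 : derivable F 0 1 by [].
  by apply: differentiable_continuous; exact/derivable1_diffP.
- by move=> x _; rewrite derive1E; exact: derive_val.
Qed.

Lemma deriv_continuous (f : R -> R) :
  (forall x : R, exists d, is_derive x 1 f d) -> continuous f.
Proof.
move=> df x; have [d dfx] := df x.
by apply: differentiable_continuous; apply/derivable1_diffP.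
Qed.

(** The primitive of [s ^+ n * expR (- t * s)] that vanishes at infinity, by repeated integration by
    parts. *)
Fixpoint powexp_prim (t : R) (n : nat) (s : R) : R :=
  if n is m.+1 then - (s ^+ m.+1 * expR (- t * s)) / t + m.+1%:R / t * powexp_prim t m s
  else - expR (- t * s) / t.

Lemma powexp_primE (t : R) n (s : R) : t != 0 ->
  is_derive s 1 (powexp_prim t n) (s ^+ n * expR (- t * s)).
Proof.
move=> t0; elim: n => [|n IH] /=.
  by der_eq => /=; field.
by der_eq => /=; field.
Qed.

Lemma powexp_prim0 (t : R) n : powexp_prim t n 0 = - (n`!%:R / t ^+ n.+1).
Proof.
elim: n => [|n IH] /=; first by rewrite mulr0 expR0 mulNr.
rewrite IH expr0n/= mul0r oppr0 mul0r add0r mulrN factS natrM [t ^+ n.+2]exprS invfM.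
by rewrite mulrACA.
Qed.

Lemma cvg_powexp_prim (t : R) n : 0 < t -> powexp_prim t n x @[x --> +oo%R] --> (0 : R).
Proof.
move=> t0; elim: n => [|n IH] /=.
  rewrite -[X in _ --> X](mul0r t^-1) -oppr0; apply: cvgMl; apply: cvgN.
  have := @cvg_powexp 0 t t0.
  by under eq_fun do rewrite expr0 mul1r.
rewrite (_ : 0 = - 0 / t + n.+1%:R / t * 0); last by rewrite oppr0 mul0r mulr0 addr0.
apply: cvgD; last exact: cvgMr.
by apply: cvgMl; apply: cvgN; exact: cvg_powexp.
Qed.

Lemma integral_powexp (t : R) n : 0 < t ->
  (\int[mu]_(s in `]0%R, +oo[) (s ^+ n * expR (- t * s))%:E = (n`!%:R / t ^+ n.+1)%:E)%E.
Proof.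
move=> t0; have tn0 : t != 0 by rewrite gt_eqF.
rewrite (ge0_FTC0y _ _ (fun x => powexp_primE n x tn0) (cvg_powexp_prim n t0)).
- by rewrite powexp_prim0 sub0r opprK.
- by move=> x x0; rewrite mulr_ge0 ?expR_ge0 ?exprn_ge0.
- by apply: deriv_continuous => x; eexists; der.
Qed.

(** The Laplace transform at [s] of the power [2k] of [sin]. Two integrations by parts, with the
    square of [cos] replaced by that of [sin], lower the exponent by two. *)
Fixpoint sinexp_lap (s : R) (k : nat) : R :=
  if k is j.+1 then (j.*2.+2 * j.*2.+1)%:R * sinexp_lap s j / (s ^+ 2 + j.*2.+2%:R ^+ 2)
  else s^-1.

(** The boundary terms of these integrations by parts. They vanish at infinity, so only the value at
    0 contributes to the integral. *)
Fixpoint sinexp_prim (s : R) (k : nat) (t : R) : R :=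
  if k is j.+1 then
    (- (expR (- s * t) * sin t ^+ (j.*2.+1) * (s * sin t + j.*2.+2%:R * cos t))
    + (j.*2.+2 * j.*2.+1)%:R * sinexp_prim s j t) / (s ^+ 2 + j.*2.+2%:R ^+ 2)
  else - expR (- s * t) / s.

Lemma sinexp_primE (s : R) k (t : R) : 0 < s ->
  is_derive t 1 (sinexp_prim s k) (expR (- s * t) * sin t ^+ k.*2).
Proof.
move=> s0; have sn0 : s != 0 by rewrite gt_eqF.
elim: k => [|k IH] /=.
  by der_eq => /=; field.
have ? : s ^+ 2 + (k.*2.+2)%:R ^+ 2 != 0.
  by rewrite gt_eqF// ltr_wpDr// ?sqr_ge0// exprn_gt0.
der_eq => /=.
rewrite -[RHS](mulfK (_ : s ^+ 2 + (k.*2.+2)%:R ^+ 2 != 0))// mulr0 addr0.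
congr (_ / _); rewrite natrM doubleS !exprS -[(k.*2.+2)%:R]natr1 expr0 mulr1.
transitivity (expR (- s * t) * sin t ^+ k.*2 * ((s ^+ 2 + k.*2.+1%:R + 1) * sin t ^+ 2
   + (k.*2.+1%:R + 1) * k.*2.+1%:R * (1 - cos t ^+ 2))); first by ring.
by rewrite cos2sin2; ring.
Qed.

Lemma sinexp_prim0 (s : R) k : sinexp_prim s k 0 = - sinexp_lap s k.
Proof.
elim: k => [|k IH] /=; first by rewrite mulr0 expR0 mulNr mul1r.
by rewrite IH sin0 expr0n/= mulr0 mul0r oppr0 add0r mulrN mulNr.
Qed.

Lemma cvg_sinexp_prim (s : R) k : 0 < s -> sinexp_prim s k x @[x --> +oo%R] --> (0 : R).
Proof.
move=> s0; elim: k => [|k IH] /=.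
  rewrite -[X in _ --> X](mul0r s^-1) -oppr0; apply: cvgMl; apply: cvgN.
  have := @cvg_powexp 0 s s0.
  by under eq_fun do rewrite expr0 mul1r.
set a := s ^+ 2 + _; set b := (k.*2.+2 * k.*2.+1)%:R.
rewrite [X in _ --> X](_ : 0 = (- 0 + b * 0) / a); last by rewrite mulr0 oppr0 addr0 mul0r.
apply: cvgMl; apply: cvgD; last exact: cvgMr.
apply: cvgN.
apply: norm_cvg0.
have e0 : (s + k.*2.+2%:R) * expR (- s * x) @[x --> +oo%R] --> (0 : R).
  rewrite -[X in _ --> X](mulr0 (s + k.*2.+2%:R)); apply: cvgMr.
  have := @cvg_powexp 0 s s0.
  by under eq_fun do rewrite expr0 mul1r.
apply: (@squeeze_cvgr _ _ _ _ (cst 0) (fun x => (s + k.*2.+2%:R) * expR (- s * x))) => //; last exact: cvg_cst.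
near=> x; rewrite normr_ge0/= !normrM (ger0_norm (expR_ge0 _)) -mulrA mulrC ler_wpM2r ?expR_ge0//.
have sn : `|sin x| <= 1 by rewrite ler_norml sin_geN1 sin_le1.
have cn : `|cos x| <= 1 by rewrite ler_norml cos_geN1 cos_le1.
rewrite -[leRHS]mul1r ler_pM//.
  by rewrite normrX exprn_ile1.
rewrite (le_trans (ler_normD _ _))// lerD//.
  by rewrite normrM gtr0_norm// ler_piMr// ltW.
by rewrite normrM ger0_norm// ler_piMr.
Unshelve. all: by end_near. Qed.

Lemma integral_sinexp (s : R) k : 0 < s ->
  (\int[mu]_(t in `]0%R, +oo[) (expR (- s * t) * sin t ^+ k.*2)%:E = (sinexp_lap s k)%:E)%E.
Proof.
move=> s0.
rewrite (ge0_FTC0y _ _ (fun x => sinexp_primE k x s0) (cvg_sinexp_prim k s0)).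
- by rewrite sinexp_prim0 sub0r opprK.
- by move=> x x0; rewrite mulr_ge0 ?expR_ge0 // -mul2n exprM exprn_ge0// sqr_ge0.
- by apply: deriv_continuous => x; eexists; der.
Qed.
End laplace.

(** * Tonelli's theorem on a rectangle *)

Section tonelli.
Context d1 d2 (T1 : measurableType d1) (T2 : measurableType d2) (R : realType).
Variables (m1 : {sigma_finite_measure set T1 -> \bar R})
  (m2 : {sigma_finite_measure set T2 -> \bar R}).

Lemma fubini_tonelli_on (D : set T1) (E : set T2) (f : T1 * T2 -> \bar R) :
  measurable D -> measurable E -> measurable_fun (D `*` E) f ->
  (forall x y, D x -> E y -> 0 <= f (x, y))%E ->
  (\int[m1]_(x in D) \int[m2]_(y in E) f (x, y) =
   \int[m2]_(y in E) \int[m1]_(x in D) f (x, y))%E.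
Proof.
move=> mD mE mf f0.
have mDE : measurable (D `*` E) by exact: measurableX.
have mg : measurable_fun setT (f \_ (D `*` E)).
  by apply/(measurable_restrictT f mDE).
have g0 z : (0 <= (f \_ (D `*` E)) z)%E.
  rewrite patchE; case: ifPn => //; rewrite inE/=; case: z => x y [/= Dx Ey].
  exact: f0.
have := fubini_tonelli (m1 := m1) (m2 := m2) _ mg g0.
have -> : (\int[m1]_x \int[m2]_y (f \_ (D `*` E)) (x, y) =
   \int[m1]_(x in D) \int[m2]_(y in E) f (x, y))%E.
  rewrite [RHS]integral_mkcond; apply: eq_integral => x _; rewrite patchE.
  case: ifPn => xD.
    rewrite [RHS]integral_mkcond; apply: eq_integral => y _; rewrite !patchE.
    by rewrite in_setX/= xD.
  by apply: integral0_eq => y _; rewrite patchE in_setX/= (negbTE xD).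
move=> ->.
rewrite [RHS]integral_mkcond; apply: eq_integral => y _; rewrite patchE.
case: ifPn => yE.
  rewrite [RHS]integral_mkcond; apply: eq_integral => x _; rewrite !patchE.
  by rewrite in_setX/= yE andbT.
by apply: integral0_eq => x _; rewrite patchE in_setX/= (negbTE yE) andbF.
Qed.
End tonelli.

(** * Moments of the cardinal sine *)

Section sinc_moments.
Context {R : realType}.
Local Notation mu := (@lebesgue_measure R).

Definition sinc (x : R) : R := if x == 0 then 1 else sin x / x.

Lemma measurable_sin : measurable_fun setT (@sin R).
Proof. by apply: continuous_measurable_fun; exact: continuous_sin. Qed.

Lemma measurable_inv : measurable_fun setT (fun x : R => x^-1).
Proof.
have m0 : measurable [set (0 : R)] by exact: measurable_set1.
rewrite -(setUv [set (0 : R)]); apply/measurable_funU => //.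
  exact: measurableC.
split; first exact: measurable_fun_set1.
apply: open_continuous_measurable_fun.
  rewrite openC; apply: accessible_closed_set1; apply: hausdorff_accessible.
  exact: Rhausdorff.
by move=> x /[!inE]/= /eqP x0; apply: cvgV => //; exact: cvg_id.
Qed.

Lemma measurable_sinc : measurable_fun setT sinc.
Proof.
apply: measurable_fun_ifT => //=.
  exact: measurable_fun_eqr.
apply: measurable_funM; first exact: measurable_sin.
exact: measurable_inv.
Qed.

(* Tonelli, writing [t ^- 2k] as a multiple of the integral of [s ^+ (2k-1) * expR (- s * t)]. *)
Lemma integral_sinc_even (k : nat) :
  (\int[mu]_(t in `]0%R, +oo[) (sinc t ^+ k.+1.*2)%:E =
   \int[mu]_(s in `]0%R, +oo[) (s ^+ k.*2.+1 / (k.*2.+1)`!%:R * sinexp_lap s k.+1)%:E)%E.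
Proof.
pose f (p : R * R) := (p.2 ^+ k.*2.+1 / (k.*2.+1)`!%:R * (expR (- p.2 * p.1) * sin p.1 ^+ k.+1.*2)).
transitivity (\int[mu]_(t in `]0%R, +oo[) \int[mu]_(s in `]0%R, +oo[) (f (t, s))%:E)%E.
  apply: eq_integral => t; rewrite inE/= in_itv/= andbT => t0.
  under eq_integral => s _.
    rewrite /f/=.
    rewrite (_ : _ * _ = (sin t ^+ k.+1.*2 / (k.*2.+1)`!%:R) * (s ^+ k.*2.+1 * expR (- t * s))); last first.
      by rewrite !mulNr [s * t]mulrC; ring.
    rewrite EFinM.
    over.
  rewrite ge0_integralZl//=.
  - rewrite integral_powexp// -EFinM /sinc gt_eqF// expr_div_n doubleS; congr EFin.
    field.
    by rewrite expf_neq0 ?gt_eqF//= ltr0n fact_gt0.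
  - apply/measurable_EFinP; apply: measurable_funTS; apply: measurable_funM => //.
    apply: measurableT_comp => //; exact: measurable_funM.
  - by move=> s; rewrite in_itv/= andbT => s0; rewrite lee_fin mulr_ge0 ?expR_ge0// exprn_ge0// ltW.
  - by rewrite lee_fin divr_ge0// -mul2n exprM exprn_ge0// sqr_ge0.
rewrite (@fubini_tonelli_on _ _ _ _ _ mu mu _ _ (EFin \o f))//=.
- apply: eq_integral => s; rewrite inE/= in_itv/= andbT => s0.
  under eq_integral do rewrite /f/= EFinM.
  rewrite ge0_integralZl//=.
  - by rewrite integral_sinexp.
  - apply/measurable_EFinP; apply: measurable_funTS; apply: measurable_funM => //.
      apply: measurableT_comp => //; exact: measurable_funM.
    by apply: measurable_funX; exact: measurable_sin.
  - by move=> t _; rewrite lee_fin mulr_ge0 ?expR_ge0 // -mul2n exprM exprn_ge0// sqr_ge0.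
  - by rewrite lee_fin divr_ge0// exprn_ge0// ltW.
- apply/measurable_EFinP; apply: measurable_funTS; rewrite /f.
  apply: measurable_funM => /=.
    apply: measurable_funM => //; apply: measurable_funX; exact: measurable_snd.
  apply: measurable_funM => /=.
    apply: measurableT_comp => //; apply: measurable_funM => //; apply: measurableT_comp => //.
  by apply: measurable_funX; apply: measurableT_comp => //; exact: measurable_sin.
- move=> t s /=; rewrite !in_itv/= !andbT => t0 s0; rewrite lee_fin /f/=.
  rewrite mulr_ge0 ?divr_ge0 ?exprn_ge0 ?(ltW s0)//.
  by rewrite mulr_ge0 ?expR_ge0 // -mul2n exprM exprn_ge0// sqr_ge0.
Qed.

Lemma is_derive_atan_div (a s : R) : a != 0 ->
  is_derive s 1 (fun x : R => atan (x / a)) (a / (s ^+ 2 + a ^+ 2)).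
Proof.
move=> a0; der_eq => /=.
have h : s ^+ 2 + a ^+ 2 != 0.
  by rewrite gt_eqF// ltr_wpDl// ?sqr_ge0// exprn_even_gt0.
have h2 : 1 + (s / a) ^+ 2 != 0.
  by rewrite gt_eqF// ltr_wpDr// ?sqr_ge0.
field. by rewrite a0 h/=.
Qed.

Lemma cvg_atan_div (a : R) : 0 < a -> atan (x / a) @[x --> +oo%R] --> (pi / 2 : R).
Proof.
move=> a0; apply: (cvg_comp (fun x => x / a) (@atan R) _ (@cvgy_atan R)).
apply/cvgryPge => r.
near=> x; rewrite ler_pdivlMr//; near: x; exact: nbhs_pinfty_ge.
Unshelve. all: by end_near. Qed.

Lemma sqrD_neq0 (s : R) (n : nat) : s ^+ 2 + n.+1%:R ^+ 2 != 0.
Proof. by rewrite gt_eqF// ltr_wpDl ?sqr_ge0// exprn_gt0. Qed.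

(** Partial fractions: [k * a / (x ^+ 2 + k ^+ 2)] is the derivative of [a * atan (x / k)], which
    grows by [a * (pi / 2)] on the half-line. The values 2, 4, 6 of [k] cover the poles occurring in
    the three moments below. *)
Lemma integral_rational (f : R -> R) (a b c : R) : (forall x, 0 <= x -> 0 <= f x) ->
  (forall x, f x = 2 * a / (x ^+ 2 + 2 ^+ 2) + 4 * b / (x ^+ 2 + 4 ^+ 2) + 6 * c / (x ^+ 2 + 6 ^+ 2)) ->
  (\int[mu]_(s in `]0%R, +oo[) (f s)%:E = ((a + b + c) * (pi / 2))%:E)%E.
Proof.
move=> f0 fE.
pose F (x : R) := a * atan (x / 2) + b * atan (x / 4) + c * atan (x / 6).
have dF x : is_derive (x : R) 1 F (f x).
  have h2 := @is_derive_atan_div 2 x (negbT (pnatr_eq0 R 2)).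
  have h4 := @is_derive_atan_div 4 x (negbT (pnatr_eq0 R 4)).
  have h6 := @is_derive_atan_div 6 x (negbT (pnatr_eq0 R 6)).
  rewrite fE.
  have := deriv_add (deriv_add (deriv_mul (deriv_cst x a) h2) (deriv_mul (deriv_cst x b) h4)) (deriv_mul (deriv_cst x c) h6).
  move=> h; apply: is_derive_eq h _.
  by rewrite !mul0r !add0r; ring.
rewrite (ge0_FTC0y f0 _ dF (l := a * (pi / 2) + b * (pi / 2) + c * (pi / 2))).
- by rewrite /F !mul0r atan0 !mulr0 !addr0 subr0 -!mulrDl.
- have -> : f = fun x => 2 * a / (x ^+ 2 + 2 ^+ 2) + 4 * b / (x ^+ 2 + 4 ^+ 2) + 6 * c / (x ^+ 2 + 6 ^+ 2) by apply/funext.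
  have cV k : continuous (fun x : R => (x ^+ 2 + k.+1%:R ^+ 2)^-1).
    move=> x; apply: cvgV; first exact: sqrD_neq0.
    by apply: cvgD; [exact: exprn_continuous|exact: cvg_cst].
  by move=> x; apply: cvgD; [apply: cvgD|]; apply: cvgMr; exact: cV.
- by apply: cvgD; [apply: cvgD|]; apply: cvgMr; exact: cvg_atan_div.
Qed.

Lemma integral_sinc2 : (\int[mu]_(t in `]0%R, +oo[) (sinc t ^+ 2)%:E = (pi / 2)%:E)%E.
Proof.
transitivity (\int[mu]_(s in `]0%R, +oo[) (2 / (s ^+ 2 + 2 ^+ 2))%:E)%E.
  apply: etrans; first exact: (integral_sinc_even 0).
  apply: eq_integral => s; rewrite inE/= in_itv/= andbT => s0; congr EFin; rewrite /= -?[0.*2]/0%N -?[1.*2]/2%N -?[2.*2]/4%N ?factS ?fact0 ?natrM ?mulr1.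
  by field; rewrite !gt_eqF ?ltr_wpDl ?sqr_ge0.
rewrite (@integral_rational _ 1 0 0) ?addr0 ?mul1r//.
  by move=> x x0; rewrite divr_ge0// addr_ge0// sqr_ge0.
by move=> x; rewrite !mulr0 !mul0r !addr0 mulr1.
Qed.

Lemma integral_sinc4 : (\int[mu]_(t in `]0%R, +oo[) (sinc t ^+ 4)%:E = (2 / 3 * (pi / 2))%:E)%E.
Proof.
transitivity (\int[mu]_(s in `]0%R, +oo[) (4 * s ^+ 2 / ((s ^+ 2 + 2 ^+ 2) * (s ^+ 2 + 4 ^+ 2)))%:E)%E.
  apply: etrans; first exact: (integral_sinc_even 1).
  apply: eq_integral => s; rewrite inE/= in_itv/= andbT => s0; congr EFin; rewrite /= -?[0.*2]/0%N -?[1.*2]/2%N -?[2.*2]/4%N ?factS ?fact0 ?natrM ?mulr1.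
  rewrite (_ : 3 * 2 = 6 :> R); last by ring.
  by field; rewrite !gt_eqF ?ltr_wpDl ?sqr_ge0.
rewrite (@integral_rational _ (- (2 / 3)) (4 / 3) 0).
- by congr EFin; field.
- by move=> x x0; rewrite divr_ge0 ?mulr_ge0 ?addr_ge0 ?sqr_ge0.
by move=> x; field; rewrite !gt_eqF ?ltr_wpDl ?sqr_ge0.
Qed.

Lemma integral_sinc6 : (\int[mu]_(t in `]0%R, +oo[) (sinc t ^+ 6)%:E = (11 / 20 * (pi / 2))%:E)%E.
Proof.
transitivity (\int[mu]_(s in `]0%R, +oo[) (6 * s ^+ 4 / ((s ^+ 2 + 2 ^+ 2) * (s ^+ 2 + 4 ^+ 2) * (s ^+ 2 + 6 ^+ 2)))%:E)%E.
  apply: etrans; first exact: (integral_sinc_even 2).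
  apply: eq_integral => s; rewrite inE/= in_itv/= andbT => s0; congr EFin; rewrite /= -?[0.*2]/0%N -?[1.*2]/2%N -?[2.*2]/4%N ?factS ?fact0 ?natrM ?mulr1.
  rewrite (_ : 3 * 2 = 6 :> R); last by ring.
  by field; rewrite !gt_eqF ?ltr_wpDl ?sqr_ge0.
(* The coefficients of the partial fraction decomposition in [s ^+ 2]; their sum is 11/20. *)
rewrite (@integral_rational _ (1 / 8) (- (8 / 5)) (81 / 40)).
- by congr EFin; field.
- move=> x x0; by rewrite divr_ge0 ?mulr_ge0 ?addr_ge0 ?sqr_ge0// exprn_ge0.
by move=> x; field; rewrite !gt_eqF ?ltr_wpDl ?sqr_ge0.
Qed.
End sinc_moments.

(** * Ball's integral inequality *)

Section binomial_bound.
Context {R : realType}.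
Local Notation mu := (@lebesgue_measure R).

(* The Taylor polynomial at 0 of [(1 - z) `^ t]. *)
Definition binom_poly (t z : R) : R :=
  1 - t * z - t * (1 - t) / 2 * z ^+ 2 - t * (1 - t) * (2 - t) / 6 * z ^+ 3
  - t * (1 - t) * (2 - t) * (3 - t) / 24 * z ^+ 4.

Lemma ge0_deriv_le (f df : R -> R) (a b : R) : a <= b ->
  (forall x : R, a <= x <= b -> is_derive x 1 f (df x)) ->
  (forall x, a < x < b -> 0 <= df x) -> f a <= f b.
Proof.
move=> ab fE df0.
apply: (@ger0_derive1_le_cc _ f a b) => //; last 2 first.
- by rewrite in_itv/= lexx.
- by rewrite in_itv/= lexx ab.
- move=> x; rewrite in_itv/= => /andP[ax xb].
  have axb : a <= x <= b by rewrite !ltW.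
  by have h := fE x axb; exact: ex_derive.
- move=> x; rewrite in_itv/= => /[dup] axb /andP[ax xb].
  have axb' : a <= x <= b by rewrite !ltW.
  by have h := fE x axb'; rewrite derive1E derive_val df0.
- apply: derivable_within_continuous => x; rewrite in_itv/= => axb.
  by have h := fE x axb; exact: ex_derive.
Qed.

(** The quotient [g] of the polynomial by the power equals 1 at 0. In its derivative all terms below
    degree four cancel, as for any truncated binomial series, and the remaining one, [dg], is
    nonnegative. *)
Lemma binom_poly_ge (t z : R) : 0 <= t <= 1 -> 0 <= z < 1 ->
  (1 - z) `^ t <= binom_poly t z.
Proof.
move=> /andP[t0 t1] /andP[z0 z1].
pose g (x : R) := binom_poly t x * expR (- t * ln (1 - x)).
suff : 1 <= g z.
  rewrite /powR gt_eqF ?subr_gt0// /g mulNr expRN ler_pdivlMr ?expR_gt0//.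
  by rewrite mul1r.
have -> : 1 = g 0 by rewrite /g (_ : ln (1 - 0) = 0) ?subr0 ?ln1// mulr0 expR0 mulr1 /binom_poly !expr0n/= !mulr0 !subr0.
pose dg (x : R) := (4 - t) * (t * (1 - t) * (2 - t) * (3 - t) / 24) * x ^+ 4 / (1 - x) * expR (- t * ln (1 - x)).
apply: (@ge0_deriv_le g dg 0 z z0) => x /andP[x0 xz]; last first.
  rewrite /dg !mulr_ge0 ?expR_ge0 ?invr_ge0 ?exprn_ge0//; lra.
have x1 : 0 < 1 - x by lra.
have dln : is_derive x 1 (fun y : R => ln (1 - y)) ((1 - x)^-1 * -1).
  apply: (@deriv_comp _ (@ln R) (fun y => 1 - y)); first exact: is_derive1_ln.
  by der_eq; ring.
have dexp : is_derive x 1 (fun y : R => expR (- t * ln (1 - y))) (expR (- t * ln (1 - x)) * (t / (1 - x))).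
  by der_eq => /=; field; rewrite gt_eqF.
rewrite /g /dg; set e := expR (- t * ln (1 - x)) in dexp *.
rewrite /binom_poly.
have dp : is_derive x 1 (fun x : R => binom_poly t x) (- t - t * (1 - t) * x - t * (1 - t) * (2 - t) / 2 * x ^+ 2 - t * (1 - t) * (2 - t) * (3 - t) / 6 * x ^+ 3).
  by rewrite /binom_poly; der_eq => /=; field.
apply: is_derive_eq (deriv_mul dp dexp) _.
by rewrite /binom_poly -/e; field; rewrite gt_eqF.
Qed.

(* The coefficients come from replacing z^3 and z^4 by their tangents at
   z = 13/20, the ratio of the first two moments of 1 - sinc^2 under the weight
   sinc^2. *)
Definition quad_lin (t : R) : R := t - t * (1 - t) * (2 - t) / 6 * (13 / 20) ^+ 2
  - t * (1 - t) * (2 - t) * (3 - t) / 24 * (2 * (13 / 20) ^+ 3).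
Definition quad_sqr (t : R) : R := t * (1 - t) / 2 + t * (1 - t) * (2 - t) / 6 * (2 * (13 / 20))
  + t * (1 - t) * (2 - t) * (3 - t) / 24 * (3 * (13 / 20) ^+ 2).

(** With [z = 1 - u], the cubic and quartic terms of [binom_poly] have nonpositive coefficients, so
    [z ^+ 3] and [z ^+ 4] may be replaced by smaller combinations of [z] and [z ^+ 2]. The errors
    have the factor [z * (z - 13 / 20) ^+ 2]. *)
Lemma powR_le_quad (t u : R) : 0 <= t <= 1 -> 0 <= u <= 1 ->
  u * u `^ t <= u * (1 - quad_lin t * (1 - u) - quad_sqr t * (1 - u) ^+ 2).
Proof.
move=> t01 /andP[u0 u1].
have [->|un0] := eqVneq u 0; first by rewrite !mul0r.
have {un0}u0 : 0 < u by rewrite lt_def un0 u0.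
apply: ler_wpM2l; first exact: ltW.
have := @binom_poly_ge t (1 - u) t01; rewrite subKr => h.
apply: le_trans (h _) _; first by apply/andP; split; lra.
rewrite /binom_poly /quad_lin /quad_sqr; set z := 1 - u.
have z0 : 0 <= z by rewrite /z; lra.
case/andP : t01 => t0 t1.
have c3 : 0 <= t * (1 - t) * (2 - t) / 6 by rewrite !mulr_ge0//; lra.
have c4 : 0 <= t * (1 - t) * (2 - t) * (3 - t) / 24 by rewrite !mulr_ge0//; lra.
have z3 : 0 <= z ^+ 3 - 2 * (13 / 20) * z ^+ 2 + (13 / 20) ^+ 2 * z.
  have -> : z ^+ 3 - 2 * (13 / 20) * z ^+ 2 + (13 / 20) ^+ 2 * z = z * (z - 13 / 20) ^+ 2 by ring.
  by rewrite mulr_ge0 ?sqr_ge0.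
have z4 : 0 <= z ^+ 4 - 3 * (13 / 20) ^+ 2 * z ^+ 2 + 2 * (13 / 20) ^+ 3 * z.
  have -> : z ^+ 4 - 3 * (13 / 20) ^+ 2 * z ^+ 2 + 2 * (13 / 20) ^+ 3 * z = z * (z - 13 / 20) ^+ 2 * (z + 2 * (13 / 20)) by field.
  by apply: mulr_ge0; [apply: mulr_ge0; [|exact: sqr_ge0]|lra].
have := mulr_ge0 c3 z3; have := mulr_ge0 c4 z4.
set k3 := t * (1 - t) * (2 - t) / 6; set k4 := t * (1 - t) * (2 - t) * (3 - t) / 24.
lra.
Qed.

Lemma quad_coef_ge0 (t : R) : 0 <= t <= 1 ->
  [/\ 0 <= quad_lin t, 0 <= quad_sqr t & quad_lin t + quad_sqr t <= 1].
Proof.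
move=> /andP[t0 t1].
have s0 : 0 <= 1 - t by lra.
have k2 : 0 <= t * (1 - t) by rewrite mulr_ge0.
have k3 : 0 <= t * (1 - t) * (2 - t) by rewrite !mulr_ge0//; lra.
have k4 : 0 <= t * (1 - t) * (2 - t) * (3 - t) by rewrite !mulr_ge0//; lra.
rewrite /quad_lin /quad_sqr; split.
- have : t * (1 - t) * (2 - t) <= t * 2 by rewrite -mulrA ler_wpM2l//; nra.
  have : t * (1 - t) * (2 - t) * (3 - t) <= t * 6.
    by rewrite -!mulrA ler_wpM2l//; nra.
  lra.
- lra.
(* This product divided by 24 is [binom_poly t 1], and [1 - quad_lin t - quad_sqr t] is at least
   that. *)
- have : 0 <= (1 - t) * (2 - t) * (3 - t) * (4 - t) by rewrite !mulr_ge0//; lra.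
  lra.
Qed.

(* The difference of the two sides is a nonnegative combination of the Bernstein polynomials
   [t ^+ k.+1 * (1 - t) ^+ (8 - k)]. *)
Lemma quad_moment_le (t : R) : 0 <= t <= 1 ->
  (1 - quad_lin t / 3 - 13 / 60 * quad_sqr t) ^+ 2 * (1 + t) <= 1.
Proof.
move=> /andP[t0 t1].
have s0 : 0 <= 1 - t by lra.
have b k : 0 <= t ^+ k.+1 * (1 - t) ^+ (8 - k) by rewrite mulr_ge0 ?exprn_ge0.
have := (b 0, b 1, b 2, b 3, b 4, b 5, b 6, b 7, b 8)%N.
move=> /= [[[[[[[[b0 b1] b2] b3] b4] b5] b6] b7] b8].
rewrite /quad_lin /quad_sqr. lra.
Qed.
End binomial_bound.

Section ge0_integral_lin.
Context d (T : measurableType d) (R : realType) (mu : {measure set T -> \bar R}).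

Lemma ge0_integral_lin (D : set T) (a b : R) (f g : T -> R) : measurable D ->
  0 <= a -> 0 <= b -> measurable_fun D f -> measurable_fun D g ->
  (forall x, D x -> 0 <= f x) -> (forall x, D x -> 0 <= g x) ->
  (\int[mu]_(x in D) (a * f x + b * g x)%:E =
   a%:E * \int[mu]_(x in D) (f x)%:E + b%:E * \int[mu]_(x in D) (g x)%:E)%E.
Proof.
move=> mD a0 b0 mf mg f0 g0.
under eq_integral do rewrite EFinD.
rewrite ge0_integralD//=.
- congr (_ + _)%E.
    rewrite -ge0_integralZl//=; first exact/measurable_EFinP.
  rewrite -ge0_integralZl//=; first exact/measurable_EFinP.
- by move=> x Dx; rewrite lee_fin mulr_ge0 ?f0.
- by apply/measurable_EFinP; exact: measurable_funM.
- by move=> x Dx; rewrite lee_fin mulr_ge0 ?g0.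
- by apply/measurable_EFinP; exact: measurable_funM.
Qed.
End ge0_integral_lin.

(** * Exponents between 2 and 4 *)

Section ball_integral_small.
Context {R : realType}.
Local Notation mu := (@lebesgue_measure R).

Lemma sin_le_id (x : R) : 0 <= x -> sin x <= x.
Proof.
move=> x0; rewrite -subr_ge0.
have := @ge0_deriv_le R (fun y => y - sin y) (fun y => 1 - cos y) 0 x x0.
rewrite sin0 subr0; by apply => y _; rewrite subr_ge0 cos_le1.
Qed.

Lemma normr_sin_le (x : R) : `|sin x| <= `|x|.
Proof.
wlog x0 : x / 0 <= x => [H|].
  have [/H//|/ltW x0] := leP 0 x.
  by rewrite -normrN -sinN -(normrN x) H// oppr_ge0.
rewrite (ger0_norm x0) ler_norml sin_le_id// andbT.
have := @ge0_deriv_le R (fun y => y + sin y) (fun y => 1 + cos y) 0 x x0.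
rewrite sin0 addr0 -lerBlDl sub0r; apply => y _.
by rewrite addrC -[1]opprK subr_ge0 cos_geN1.
Qed.

Lemma normr_sinc_le1 (x : R) : `|sinc x| <= 1.
Proof.
rewrite /sinc; case: eqVneq => [_|x0]; first by rewrite normr1.
by rewrite normrM normfV ler_pdivrMr ?normr_gt0// mul1r normr_sin_le.
Qed.

Lemma sincM (x : R) : sinc x * x = sin x.
Proof. by rewrite /sinc; case: eqVneq => [->|x0]; rewrite ?mulr0 ?sin0// divfK. Qed.

Lemma measurable_sinc_powR (p : R) : measurable_fun setT (fun t : R => `|sinc t| `^ p).
Proof.
apply: (measurableT_comp (measurable_powR p)).
by apply: measurableT_comp => //; exact: measurable_sinc.
Qed.

(** With [p = 2 + 2 * t] the integrand is [u] times its power [t], where [u = sinc x ^+ 2].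
    Integrating [powR_le_quad] against the exact moments leaves a comparison with
    [1 / Num.sqrt (1 + t) = Num.sqrt (2 / p)], which is [quad_moment_le]. *)
Lemma ball_integral_le4 (p : R) : 2 <= p <= 4 ->
  (\int[mu]_(t in `]0%R, +oo[) (`|sinc t| `^ p)%:E <= (pi / 2 * Num.sqrt (2 / p))%:E)%E.
Proof.
move=> /andP[p2 p4].
pose t := (p - 2) / 2.
have t01 : 0 <= t <= 1 by rewrite /t; apply/andP; split; lra.
have [A0 B0 AB1] := quad_coef_ge0 t01.
set A := quad_lin t in A0 AB1; set B := quad_sqr t in B0 AB1.
have mS n : measurable_fun setT (fun t : R => sinc t ^+ n).
  by apply: measurable_funX; exact: measurable_sinc.
have S0 n (x : R) : 0 <= sinc x ^+ n.*2 by rewrite -mul2n exprM exprn_ge0 ?sqr_ge0.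
(* The sixth power is kept on the left, so that all coefficients are nonnegative by [quad_coef_ge0]
   and both sides can be integrated term by term. *)
have key (x : R) : `|sinc x| `^ p + B * sinc x ^+ 6 <= (1 - A - B) * sinc x ^+ 2 + (A + 2 * B) * sinc x ^+ 4.
  have u01 : 0 <= sinc x ^+ 2 <= 1.
    by rewrite sqr_ge0/= -real_normK ?num_real// exprn_ile1// normr_sinc_le1.
  have := powR_le_quad t01 u01; rewrite -/A -/B.
  have -> : sinc x ^+ 2 * (sinc x ^+ 2) `^ t = `|sinc x| `^ p.
    have -> : p = 2 + 2 * t by rewrite /t; field.
    rewrite powRD; last first.
      by apply/implyP => /eqP h0; case/andP: t01 => ? _; exfalso; lra.
    have e2 : `|sinc x| `^ 2 = sinc x ^+ 2.
      by rewrite (@powR_mulrn _ _ 2 (normr_ge0 _)) real_normK ?num_real.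
    by rewrite powRrM e2.
  move=> h; suff : sinc x ^+ 2 * (1 - A * (1 - sinc x ^+ 2) - B * (1 - sinc x ^+ 2) ^+ 2) =
     (1 - A - B) * sinc x ^+ 2 + (A + 2 * B) * sinc x ^+ 4 - B * sinc x ^+ 6 by lra.
  by ring.
have mSD n : measurable_fun (`]0, +oo[%classic : set R) (fun t : R => sinc t ^+ n).
  exact: measurable_funTS.
have E : (\int[mu]_(x in `]0%R, +oo[) (1 * `|sinc x| `^ p + B * sinc x ^+ 6)%:E <=
  \int[mu]_(x in `]0%R, +oo[) ((1 - A - B) * sinc x ^+ 2 + (A + 2 * B) * sinc x ^+ 4)%:E)%E.
  apply: ge0_le_integral => //=.
  - by move=> x _; rewrite lee_fin addr_ge0// mulr_ge0 ?powR_ge0 ?(S0 3).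
  - apply/measurable_EFinP; apply: measurable_funD; apply: measurable_funM => //.
      by apply: measurable_funTS; exact: measurable_sinc_powR.
    exact: mSD.
  - apply/measurable_EFinP; apply: measurable_funD; apply: measurable_funM => //; exact: mSD.
  - by move=> x _; rewrite lee_fin mul1r.
move: E; rewrite !ge0_integral_lin//=; last first.
all: try solve [by move=> x _; rewrite ?powR_ge0 ?(S0 1%N) ?(S0 2%N) ?(S0 3%N)
  | exact: mSD | by apply: measurable_funTS; exact: measurable_sinc_powR].
  lra.
  lra.
rewrite integral_sinc2 integral_sinc4 integral_sinc6 mul1e -!EFinM -EFinD.
set I := (\int[mu]_(x in _) _)%E.
have I0 : (0 <= I)%E by apply: integral_ge0 => x _; rewrite lee_fin powR_ge0.
case: I I0 => [r||] //; rewrite lee_fin => r0.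
rewrite -EFinD !lee_fin => h.
have pi0 : 0 <= pi / 2 :> R by rewrite divr_ge0 ?pi_ge0.
have : r <= pi / 2 * (1 - A / 3 - 13 / 60 * B) by lra.
move=> /le_trans; apply; rewrite ler_wpM2l//.
apply: le_trans (ler_norm _) _; rewrite -sqrtr_sqr ler_wsqrtr//.
have := quad_moment_le t01; rewrite -/A -/B.
have -> : 1 + t = p / 2 by rewrite /t; field.
move=> hq; rewrite -[leRHS]mulr1 -ler_pdivrMl; last by rewrite divr_gt0//; lra.
by rewrite invf_div mulrC.
Qed.
End ball_integral_small.

(** * Taylor bounds and the Gaussian majorant of the cardinal sine *)

Section taylor.
Context {R : realType}.
Implicit Types x : R.

(** The derivative of each Taylor remainder below is the remainder one degree lower, so the signs
    propagate by this rule. *)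
Lemma ge0_by_deriv (f df : R -> R) x : 0 <= x -> (forall y : R, is_derive y 1 f (df y)) ->
  0 <= f 0 -> (forall y, 0 <= y -> 0 <= df y) -> 0 <= f x.
Proof.
move=> x0 fE f0 df0; apply: le_trans f0 _.
apply: (@ge0_deriv_le R f df 0 x x0) => y.
by move=> /andP[/ltW y0 _]; exact: df0.
Qed.

Lemma cos_ge_poly2 x : 0 <= x -> 0 <= cos x - (1 - x ^+ 2 / 2).
Proof.
move=> x0; apply: (@ge0_by_deriv (fun y => cos y - (1 - y ^+ 2 / 2)) (fun y => y - sin y) x x0).
- by move=> y; der_eq => /=; field.
- by rewrite cos0 expr0n/= mul0r subr0 subrr.
- by move=> y y0; rewrite subr_ge0 sin_le_id.
Qed.

Lemma sin_ge_poly3 x : 0 <= x -> 0 <= sin x - (x - x ^+ 3 / 6).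
Proof.
move=> x0; apply: (@ge0_by_deriv (fun y => sin y - (y - y ^+ 3 / 6)) (fun y => cos y - (1 - y ^+ 2 / 2)) x x0).
- by move=> y; der_eq => /=; field.
- by rewrite sin0 expr0n/= mul0r !subr0.
- exact: cos_ge_poly2.
Qed.

Lemma cos_le_poly4 x : 0 <= x -> 0 <= 1 - x ^+ 2 / 2 + x ^+ 4 / 24 - cos x.
Proof.
move=> x0; apply: (@ge0_by_deriv (fun y => 1 - y ^+ 2 / 2 + y ^+ 4 / 24 - cos y) (fun y => sin y - (y - y ^+ 3 / 6)) x x0).
- by move=> y; der_eq => /=; field.
- by rewrite cos0 !expr0n/= !mul0r subr0 addr0 subrr.
- exact: sin_ge_poly3.
Qed.

Lemma sin_le_poly5 x : 0 <= x -> 0 <= x - x ^+ 3 / 6 + x ^+ 5 / 120 - sin x.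
Proof.
move=> x0; apply: (@ge0_by_deriv (fun y => y - y ^+ 3 / 6 + y ^+ 5 / 120 - sin y) (fun y => 1 - y ^+ 2 / 2 + y ^+ 4 / 24 - cos y) x x0).
- by move=> y; der_eq => /=; field.
- by rewrite sin0 !expr0n/= !mul0r !subr0 addr0.
- exact: cos_le_poly4.
Qed.

Lemma cos_ge_poly6 x : 0 <= x -> 0 <= cos x - (1 - x ^+ 2 / 2 + x ^+ 4 / 24 - x ^+ 6 / 720).
Proof.
move=> x0; apply: (@ge0_by_deriv (fun y => cos y - (1 - y ^+ 2 / 2 + y ^+ 4 / 24 - y ^+ 6 / 720)) (fun y => y - y ^+ 3 / 6 + y ^+ 5 / 120 - sin y) x x0).
- by move=> y; der_eq => /=; field.
- by rewrite cos0 !expr0n/= !mul0r !subr0 addr0 subrr.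
- exact: sin_le_poly5.
Qed.

Lemma expRN_ge_poly3 x : 0 <= x -> 0 <= expR (- x) - (1 - x + x ^+ 2 / 2 - x ^+ 3 / 6).
Proof.
have e1 y : 0 <= y :> R -> 0 <= 1 - y + y ^+ 2 / 2 - expR (- y).
  move=> y0; apply: (@ge0_by_deriv (fun y => 1 - y + y ^+ 2 / 2 - expR (- y)) (fun y => expR (- y) - (1 - y)) y y0).
  - by move=> z; der_eq => /=; field.
  - by rewrite oppr0 expR0 expr0n/= mul0r !addr0 subrr.
  - by move=> z z0; rewrite subr_ge0 expR_ge1Dx.
move=> x0; apply: (@ge0_by_deriv (fun y => expR (- y) - (1 - y + y ^+ 2 / 2 - y ^+ 3 / 6)) (fun y => 1 - y + y ^+ 2 / 2 - expR (- y)) x x0); last exact: e1.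
- by move=> z; der_eq => /=; field.
- by rewrite oppr0 expR0 !expr0n/= !mul0r ?oppr0 !addr0 ?subr0 subrr.
Qed.

(** If [pi] were smaller, the degree six lower bound of the cosine would be positive at [pi / 2],
    where the cosine vanishes. *)
Lemma pi_gt312 : 312 / 100 < pi :> R.
Proof.
rewrite ltNge; apply/negP => pile.
have p0 := @pi_ge2 R.
have := @cos_ge_poly6 (pi / 2); rewrite cos_pihalf => /(_ _)/wrap[]; first by lra.
set z := (pi / 2) ^+ 2.
have -> : (pi / 2 : R) ^+ 4 = z ^+ 2 by rewrite /z -exprM.
have -> : (pi / 2 : R) ^+ 6 = z ^+ 3 by rewrite /z -exprM.
have q1 : 0 <= (pi - 2) * (pi + 2) :> R by apply: mulr_ge0; lra.
have q2 : 0 <= (312 / 100 - pi) * (312 / 100 + pi) :> R by apply: mulr_ge0; lra.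
have z1 : 1 <= z by rewrite /z; lra.
have z2 : z <= 61 / 25 by rewrite /z; lra.
move: z z1 z2 => z z1 z2.
nra.
Qed.

(** The degree three lower bound of the exponential at [- (x ^+ 2 / 6)], multiplied by [x], exceeds
    the degree five upper bound of [sin] by [x ^+ 5 * (36 / 5 - x ^+ 2) / 1296]; hence the constant
    36/5. *)
Lemma normr_sinc_le_gauss x : 0 < x -> x ^+ 2 <= 36 / 5 -> `|sinc x| <= expR (- (x ^+ 2 / 6)).
Proof.
move=> x0 x2.
have xpi : x <= pi.
  have := pi_gt312 => h; nra.
rewrite /sinc gt_eqF// ger0_norm; last first.
  by rewrite divr_ge0 ?(ltW x0)// sin_ge0_pi// (ltW x0).
rewrite ler_pdivrMr//.
have h1 := sin_le_poly5 (ltW x0).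
have y0 : 0 <= x ^+ 2 / 6 by rewrite divr_ge0 ?sqr_ge0.
have h2 := expRN_ge_poly3 y0.
have h3 : 0 <= x * (expR (- (x ^+ 2 / 6)) - (1 - x ^+ 2 / 6 + (x ^+ 2 / 6) ^+ 2 / 2 - (x ^+ 2 / 6) ^+ 3 / 6)).
  by rewrite mulr_ge0// ltW.
have h4 : 0 <= x * (x ^+ 4 * (36 / 5 - x ^+ 2)).
  by rewrite mulr_ge0 ?(ltW x0)// mulr_ge0 ?exprn_ge0 ?(ltW x0)// subr_ge0.
rewrite [leRHS]mulrC.
move: h1 h3 h4; set e := expR _; set s := sin x; lra.
Qed.
End taylor.

(** * Gaussian integral and tail of the cardinal sine *)

Section tail_estimates.
Context {R : realType}.
Local Notation mu := (@lebesgue_measure R).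

Lemma integral_gauss_scale (c : R) : 0 < c ->
  (\int[mu]_(x in `]0%R, +oo[) (expR (- (c * x) ^+ 2))%:E = (Num.sqrt pi / (2 * c))%:E)%E.
Proof.
move=> c0.
have mg : measurable_fun setT (@gauss_fun R) by exact: measurable_gauss_fun.
have := @ge0_integral_affine R c 0 `]0, +oo[%classic (fun x => (gauss_fun x)%:E).
have -> : (fun t : R => c * t + 0) @^-1` `]0, +oo[%classic = `]0, +oo[%classic.
  by apply/seteqP; split => x /=; rewrite !in_itv/= !andbT addr0 pmulr_rgt0.
rewrite integral_itv_obnd_cbnd; last exact/measurable_EFinP/measurable_funTS.
rewrite integral0y_gauss => /(_ _ _ _ _)/wrap[].
- by rewrite gt_eqF.
- by [].
- exact/measurable_EFinP/measurable_funTS.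
- by move=> x _; rewrite lee_fin gauss_fun_ge0.
move=> h.
have h2 : ((c^-1)%:E * (Num.sqrt pi / 2)%:E = (c^-1)%:E * (`|c|%:E *
    \int[mu]_(x in `]0%R, +oo[) (gauss_fun (c * x + 0)%R)%:E))%E by rewrite h.
move: h2; rewrite muleA -!EFinM gtr0_norm// mulVf ?gt_eqF// mul1e => h2.
transitivity (\int[mu]_(x in `]0%R, +oo[) (gauss_fun (c * x + 0))%:E)%E.
  by apply: eq_integral => x _; rewrite addr0.
by rewrite -h2; congr EFin; field; rewrite gt_eqF.
Qed.

Lemma integral_invX4 (c : R) : 0 < c ->
  (\int[mu]_(x in `[c, +oo[) (x ^- 4)%:E = ((3 * c ^+ 3)^-1)%:E)%E.
Proof.
move=> c0.
have dV (x : R) : c <= x -> is_derive x 1 (fun y : R => - (y ^- 3) / 3) (x ^- 4).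
  move=> cx; have x0 : x != 0 by rewrite gt_eqF// (lt_le_trans c0).
  have d3 : is_derive x 1 (fun y : R => y ^+ 3) (3 * x ^+ 2).
    by der_eq => /=; ring.
  have dinv := @is_deriveV R (fun y => y ^+ 3) x (3 * x ^+ 2) 1 (expf_neq0 3 x0) d3.
  apply: is_derive_eq (deriv_mul (deriv_opp dinv) (deriv_cst x (3^-1))) _.
  by rewrite /= mulr0 addr0 /GRing.scale/=; field.
have cF (x : R) : c <= x -> {for x, continuous (fun y : R => - (y ^- 3) / 3)}.
  by move=> cx; have h := dV x cx; apply: differentiable_continuous; apply/derivable1_diffP.
rewrite (@ge0_continuous_FTC2y R (fun x => x ^- 4) (fun y => - (y ^- 3) / 3) c 0).
- by rewrite -EFinB; congr EFin; field; rewrite gt_eqF.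
- by move=> x cx; rewrite invr_ge0 exprn_ge0// (le_trans (ltW c0)).
- apply: continuous_in_subspaceT => x; rewrite inE/= in_itv/= andbT => cx.
  apply: cvgV; last exact: exprn_continuous.
  by rewrite expf_neq0// gt_eqF// (lt_le_trans c0).
- rewrite -[X in _ --> X](mul0r 3^-1) -oppr0; apply: cvgMl; apply: cvgN.
  apply/gtr0_cvgV0.
    near=> x; rewrite exprn_gt0//; near: x; exact: nbhs_pinfty_gt.
  apply/cvgryPge => r; near=> x.
  have x1 : 1 <= x by near: x; exact: nbhs_pinfty_ge.
  have xr : r <= x by near: x; apply: nbhs_pinfty_ge; rewrite num_real.
  by rewrite (le_trans xr)// ler_eXnr.
- by move=> x cx; have h := dV x (ltW cx); exact: ex_derive.
- by apply: cvg_at_right_filter; exact: cF.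
- move=> x; rewrite in_itv/= andbT => cx; have h := dV x (ltW cx).
  by rewrite derive1E derive_val.
Unshelve. all: by end_near. Qed.

(** Of the [p] factors bounded by [x^-1], four are kept for integrability. The others yield decay in
    [p]: they are at most [expR (- (1 / 2))] each, and [expR (- y) <= 1 / (1 + y)] at
    [y = (p - 4) / 2]. *)
Lemma normr_sinc_tail (p x : R) : 4 <= p -> 67 / 25 <= x ->
  `|sinc x| `^ p <= 2 / (p - 2) * x ^- 4.
Proof.
move=> p4 x2.
have x0 : 0 < x by lra.
have s1 : `|sinc x| <= x^-1.
  rewrite /sinc gt_eqF// normrM normfV (gtr0_norm x0) ler_piMl ?invr_ge0 ?(ltW x0)//.
  exact: sin_max.
have -> : p = 4 + (p - 4) by ring.
rewrite powRD; last by apply/implyP => /eqP; lra.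
rewrite mulrC ler_pM ?powR_ge0//; last first.
  rewrite (@powR_mulrn _ _ 4 (normr_ge0 _)) -exprVn; apply: lerXn2r => //.
  by rewrite nnegrE invr_ge0 ltW.
have e2 : expR (- (1 / 2)) >= x^-1 :> R.
  have := expR_ge1Dx (- (1 / 2) : R) => h.
  apply: le_trans (_ : 1 / 2 <= _); last lra.
  by rewrite div1r lef_pV2 ?posrE//; lra.
apply: (@le_trans _ _ (expR (- (1 / 2)) `^ (p - 4))).
  by rewrite ge0_ler_powR ?nnegrE ?expR_ge0//; [lra|exact: le_trans e2].
rewrite -expRM mulNr expRN.
have h : 0 < 1 + 1 / 2 * (p - 4) by lra.
apply: (@le_trans _ _ (1 + 1 / 2 * (p - 4))^-1).
  by rewrite lef_pV2 ?posrE ?expR_gt0// expR_ge1Dx.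
rewrite le_eqVlt; apply/orP; left; apply/eqP; field.
by rewrite !gt_eqF//; lra.
Qed.
End tail_estimates.

(** * Exponents at least 4 *)

Section ball_integral_large.
Context {R : realType}.
Local Notation mu := (@lebesgue_measure R).

(** Here [q], [w], [v] stand for the square roots of pi, 2 and 3, and 35/1000 bounds the tail. The
    room is [q * w * (q - v) / 2], positive because pi exceeds 3; the rational bounds below make it
    quantitative. *)
Lemma gauss_tail_slack (q w v : R) : 0 < q -> 0 < w -> 0 < v ->
  w ^+ 2 = 2 -> v ^+ 2 = 3 -> 312 / 100 < q ^+ 2 ->
  q * w * v / 2 + 35 / 1000 <= q ^+ 2 * w / 2.
Proof.
move=> q0 w0 v0 w2 v2 q2.
have qle : 30 / 17 <= q by clear w0 v0 w2 v2; nra.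
have wle : 7 / 5 <= w by clear q0 v0 q2 v2 qle; nra.
have vle : v <= 26 / 15 by clear q0 w0 q2 w2 qle wle; nra.
have qw : 30 / 17 * (7 / 5) <= q * w by apply: ler_pM => //; lra.
have qv : 1 / 32 <= q - v by clear -qle vle; lra.
have : 30 / 17 * (7 / 5) * (1 / 32) <= q * w * (q - v) by apply: ler_pM => //; lra.
clear -qle vle; lra.
Qed.

Lemma ball_integral_ge4 (p : R) : 4 <= p ->
  (\int[mu]_(t in `]0%R, +oo[) (`|sinc t| `^ p)%:E <= (pi / 2 * Num.sqrt (2 / p))%:E)%E.
Proof.
(* [67 / 25] is slightly below the bound [sqrt (36 / 5)] of [normr_sinc_le_gauss]. *)
move=> p4; pose c : R := 67 / 25.
have c0 : 0 < c by rewrite /c; lra.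
have p0 : 0 < p by lra.
have mS : measurable_fun setT (fun t : R => (`|sinc t| `^ p)%:E).
  by apply/measurable_EFinP; exact: measurable_sinc_powR.
have -> : (`]0, +oo[%classic : set R) = `]0, c[%classic `|` `[c, +oo[%classic.
  by rewrite -itv_bndbnd_setU// bnd_simp.
rewrite ge0_integral_setU//=; last 2 first.
- exact: measurable_funTS.
- apply/disj_setPS => x [] /=; rewrite !in_itv/= andbT => /andP[_ xc] cx.
  by move: xc; rewrite ltNge cx.
pose a := Num.sqrt (p / 6).
have a0 : 0 < a by rewrite sqrtr_gt0 divr_gt0.
have main : (\int[mu]_(t in `]0%R, c[) (`|sinc t| `^ p)%:E <= (Num.sqrt pi / (2 * a))%:E)%E.
  rewrite -integral_gauss_scale//.
  have mg : measurable_fun setT (fun t : R => (expR (- (a * t) ^+ 2))%:E).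
    apply/measurable_EFinP; apply: measurableT_comp => //; apply: measurableT_comp => //.
    by apply: measurable_funX; exact: measurable_funM.
  apply: (@le_trans _ _ (\int[mu]_(t in `]0%R, c[) (expR (- (a * t) ^+ 2))%:E)%E).
    apply: ge0_le_integral => //=.
    - exact: measurable_funTS.
    - exact: measurable_funTS.
    - move=> x; rewrite in_itv/= => /andP[x0 xc]; rewrite lee_fin.
      have x2 : x ^+ 2 <= 36 / 5 by move: xc; rewrite /c => ?; nra.
      have -> : expR (- (a * x) ^+ 2) = expR (- (x ^+ 2 / 6)) `^ p.
        rewrite -expRM exprMn sqr_sqrtr ?divr_ge0 ?(ltW p0)//; congr expR; by field.
      rewrite ge0_ler_powR ?nnegrE ?expR_ge0 ?(ltW p0)//.
      exact: normr_sinc_le_gauss.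
  apply: ge0_subset_integral => //=.
  - exact: measurable_funTS.
  - by apply: subset_itvl; rewrite bnd_simp.
have tail : (\int[mu]_(t in `[c, +oo[) (`|sinc t| `^ p)%:E <= (2 / (p - 2) * (3 * c ^+ 3)^-1)%:E)%E.
  have mi : measurable_fun setT (fun x : R => (x ^- 4)%:E).
    by apply/measurable_EFinP; apply: (measurableT_comp (measurable_inv)); exact: measurable_funX.
  rewrite EFinM -integral_invX4// -ge0_integralZl//=; last 3 first.
  - exact: measurable_funTS.
  - by move=> x _; rewrite lee_fin invr_ge0 exprn_even_ge0.
  - by rewrite lee_fin divr_ge0//; lra.
  apply: ge0_le_integral => //=.
  - exact: measurable_funTS.
  - by apply: measurable_funTS; apply/measurable_EFinP; apply: measurable_funM => //; exact/measurable_EFinP.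
  - move=> x; rewrite in_itv/= andbT => cx; rewrite -EFinM lee_fin.
    exact: normr_sinc_tail.
apply: le_trans (leeD main tail) _; rewrite -EFinD lee_fin.
pose s := Num.sqrt p; pose w := Num.sqrt 2 : R; pose v := Num.sqrt 3 : R; pose q := Num.sqrt pi : R.
have s0 : 0 < s by rewrite sqrtr_gt0.
have s2 : s ^+ 2 = p by rewrite sqr_sqrtr// ltW.
have w2 : w ^+ 2 = 2 by rewrite sqr_sqrtr.
have v2 : v ^+ 2 = 3 by rewrite sqr_sqrtr.
have q2 : q ^+ 2 = pi by rewrite sqr_sqrtr// pi_ge0.
have w0 : 0 < w by rewrite sqrtr_gt0.
have v0 : 0 < v by rewrite sqrtr_gt0.
have q0 : 0 < q by rewrite sqrtr_gt0 pi_gt0.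
have -> : Num.sqrt (2 / p) = w / s by rewrite sqrtrM// sqrtrV// ltW.
have -> : a = s / (w * v).
  rewrite /a sqrtrM ?(ltW p0)// sqrtrV//; congr (_ / _).
  by rewrite /w /v -sqrtrM//; congr Num.sqrt; ring.
have s2' : 2 <= s by nra.
(* This puts the tail on the scale [1 / s] of the other two terms. Once [s] is cancelled, a
   numerical inequality without [p] remains. *)
have hps : 2 / (p - 2) <= 2 / s.
  rewrite ler_pM2l// lef_pV2 ?posrE//; last by lra.
  by rewrite -s2; nra.
have c3 : 0 < (3 * c ^+ 3)^-1 by rewrite invr_gt0 mulr_gt0// exprn_gt0.
rewrite -/q -q2.
apply: (@le_trans _ _ (q / (2 * (s / (w * v))) + 2 / s * (3 * c ^+ 3)^-1)).
  by rewrite lerD2l ler_pM2r.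
have -> : q / (2 * (s / (w * v))) + 2 / s * (3 * c ^+ 3)^-1 = (q * w * v / 2 + 2 / (3 * c ^+ 3)) / s.
  by field; rewrite !gt_eqF.
have -> : q ^+ 2 / 2 * (w / s) = (q ^+ 2 * w / 2) / s by field; rewrite gt_eqF.
rewrite ler_pM2r ?invr_gt0//.
have c3' : 2 / (3 * c ^+ 3) <= 35 / 1000 by rewrite /c; lra.
apply: le_trans (_ : q * w * v / 2 + 35 / 1000 <= _); first by rewrite lerD2l.
by apply: gauss_tail_slack => //; rewrite q2; exact: pi_gt312.
Qed.

Theorem ball_integral (p : R) : 2 <= p ->
  (\int[mu]_(t in `]0%R, +oo[) (`|sinc t| `^ p)%:E <= (pi / 2 * Num.sqrt (2 / p))%:E)%E.
Proof.
move=> p2; have [p4|/ltW p4] := leP p 4; last exact: ball_integral_ge4.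
by apply: ball_integral_le4; rewrite p2.
Qed.
End ball_integral_large.

(** * Products of cardinal sines *)

Section ball_product.
Context {R : realType}.
Local Notation mu := (@lebesgue_measure R).

(* Weighted AM-GM, by summing the tangent inequalities of exp at the logarithm of the product. *)
Lemma prod_le_sum_powR (I : finType) (a y : I -> R) :
  \sum_i a i ^+ 2 = 1 -> (forall i, 0 <= y i) -> (forall i, a i = 0 -> y i = 1) ->
  \prod_i y i <= \sum_i a i ^+ 2 * y i `^ (a i ^- 2).
Proof.
move=> a1 y0 ya.
have rhs0 : 0 <= \sum_i a i ^+ 2 * y i `^ (a i ^- 2).
  by apply: sumr_ge0 => i _; rewrite mulr_ge0 ?sqr_ge0 ?powR_ge0.
have [/existsP[i /eqP yi0]|/existsPn yn0] := boolP [exists i, y i == 0].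
  by rewrite (bigD1 i)//= yi0 mul0r.
have yp i : 0 < y i by rewrite lt_def yn0 y0.
pose L := \sum_i ln (y i).
have -> : \prod_i y i = expR L.
  by rewrite /L expR_sum; apply: eq_bigr => i _; rewrite lnK// posrE.
(* The corrections [ln (y i) * a i ^- 2 - L] have weighted mean zero, as [L] is the weighted mean of
   the first terms. An index with [a i = 0] is harmless because then [ln (y i) = 0]. *)
have -> : expR L = \sum_i a i ^+ 2 * (expR L * (1 + (ln (y i) * a i ^- 2 - L))).
  under eq_bigr do rewrite mulrCA mulrDr mulr1 mulrBr.
  rewrite -mulr_sumr big_split/= a1 sumrB -mulr_suml a1 mul1r.
  rewrite (_ : \sum_i a i ^+ 2 * (ln (y i) * a i ^- 2) = L) ?subrr ?addr0 ?mulr1//.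
  apply: eq_bigr => i _; have [a0|a0] := eqVneq (a i) 0.
    by rewrite ya// ln1 mul0r mulr0.
  by rewrite mulrC mulfVK// sqrf_eq0.
apply: ler_sum => i _; rewrite ler_wpM2l ?sqr_ge0//.
rewrite /powR gt_eqF// mulrC -ler_pdivlMr ?expR_gt0// -expRN -expRD mulrC.
exact: expR_ge1Dx.
Qed.

Lemma sincN (x : R) : sinc (- x) = sinc x.
Proof. by rewrite /sinc oppr_eq0 sinN invrN mulrNN. Qed.

Lemma sinc0 : sinc 0 = 1 :> R. Proof. by rewrite /sinc eqxx. Qed.

(** For [p = a ^- 2] the factor [Num.sqrt (2 / p)] is proportional to the absolute value of [a],
    which the change of variables cancels. The bound is thus the same for all [a], so the weights
    [a i ^+ 2] simply add up to 1. *)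
Lemma ball_integral_scale (a : R) : a != 0 -> a ^+ 2 <= 1 / 2 ->
  (\int[mu]_(t in `]0%R, +oo[) (`|sinc (a * t)| `^ (a ^- 2))%:E <= (pi / 2 * Num.sqrt 2)%:E)%E.
Proof.
wlog a0 : a / 0 < a => [H an0 a2|_ a2].
  have [a0|a0] := ltP 0 a; first exact: H.
  have := H (- a); rewrite oppr_gt0 oppr_eq0 sqrrN => /(_ _ an0 a2)/wrap[].
    by rewrite lt_neqAle an0 a0.
  move=> h; apply: le_trans h; rewrite le_eqVlt; apply/orP; left; apply/eqP.
  by apply: eq_integral => t _; rewrite mulNr sincN.
have an0 : a != 0 by rewrite gt_eqF.
pose p := a ^- 2.
have p2 : 2 <= p.
  by rewrite /p -[2]invrK lef_pV2 ?posrE ?exprn_gt0 ?invr_gt0// -div1r.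
have := ball_integral p2.
rewrite (@ge0_integral_affine R a 0)//; last first.
  by apply/measurable_EFinP; apply: measurable_funTS; exact: measurable_sinc_powR.
have -> : (fun t : R => a * t + 0) @^-1` `]0, +oo[%classic = `]0, +oo[%classic.
  by apply/seteqP; split => x /=; rewrite !in_itv/= !andbT addr0 pmulr_rgt0.
under eq_integral do rewrite addr0.
rewrite gtr0_norm// -lee_pdivlMl//; rewrite -EFinM => /le_trans; apply.
rewrite lee_fin /p invrK sqrtrM// sqrtr_sqr gtr0_norm//.
by rewrite le_eqVlt; apply/orP; left; apply/eqP; field.
Qed.

Lemma measurable_prod_sinc (I : eqType) (s : seq I) (a : I -> R) :
  measurable_fun setT (fun t : R => \prod_(i <- s) sinc (a i * t)).
Proof.
apply: measurable_prod => i _.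
by apply: (measurableT_comp measurable_sinc); exact: measurable_funM.
Qed.

Lemma normr_prod_sinc_le1 (I : Type) (s : seq I) (a : I -> R) (t : R) :
  `|\prod_(i <- s) sinc (a i * t)| <= 1.
Proof. by rewrite normr_prod prodr_ile1// => i _; rewrite normr_ge0 normr_sinc_le1. Qed.

Theorem ball_product (I : finType) (a : I -> R) :
  \sum_i a i ^+ 2 = 1 -> (forall i, a i ^+ 2 <= 1 / 2) ->
  (\int[mu]_(t in `]0%R, +oo[) `|\prod_i sinc (a i * t)|%:E <= (pi / 2 * Num.sqrt 2)%:E)%E.
Proof.
move=> a1 a2.
pose g i (t : R) := a i ^+ 2 * `|sinc (a i * t)| `^ (a i ^- 2).
have mg i : measurable_fun setT (g i).
  apply: measurable_funM => //; apply: (measurableT_comp (measurable_powR _)).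
  apply: measurableT_comp => //; apply: (measurableT_comp measurable_sinc).
  exact: measurable_funM.
have g0 i t : 0 <= g i t by rewrite mulr_ge0 ?sqr_ge0 ?powR_ge0.
apply: (@le_trans _ _ (\int[mu]_(t in `]0%R, +oo[) (\sum_i (g i t)%:E))%E).
  apply: ge0_le_integral => //=.
  - apply/measurable_EFinP; apply: measurable_funTS; apply: measurableT_comp => //.
    exact: measurable_prod_sinc.
  - by apply: emeasurable_sum => i; apply/measurable_EFinP; apply: measurable_funTS; exact: mg.
  - move=> t _; rewrite sumEFin lee_fin normr_prod prod_le_sum_powR// => i ai0.
    by rewrite ai0 mul0r sinc0 normr1.
rewrite ge0_integral_sum//=; last 2 first.
- by move=> i; apply/measurable_EFinP; apply: measurable_funTS; exact: mg.
- by move=> i t _; rewrite lee_fin.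
have -> : pi / 2 * Num.sqrt 2 = \sum_i a i ^+ 2 * (pi / 2 * Num.sqrt 2) :> R.
  by rewrite -mulr_suml a1 mul1r.
rewrite -sumEFin; apply: lee_sum => i _.
have [ai0|ai0] := eqVneq (a i) 0.
  rewrite ai0 expr0n/= mul0r integral0_eq// => t _.
  by rewrite /g ai0 expr0n/= mul0r.
under eq_integral do rewrite /g EFinM.
rewrite ge0_integralZl//=; last 2 first.
- apply/measurable_EFinP; apply: measurable_funTS.
  apply: (measurableT_comp (measurable_powR _)).
  apply: measurableT_comp => //; apply: (measurableT_comp measurable_sinc).
  exact: measurable_funM.
- by rewrite lee_fin sqr_ge0.
rewrite [leRHS]EFinM; apply: lee_wpmul2l; first by rewrite lee_fin sqr_ge0.
exact: ball_integral_scale.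
Qed.
End ball_product.

(** * Tonelli's theorem over a planar region, by sections *)

Section tonelli_sections.
Context d1 d2 (T1 : measurableType d1) (T2 : measurableType d2) (R : realType).
Variables (m1 : {sigma_finite_measure set T1 -> \bar R})
  (m2 : {sigma_finite_measure set T2 -> \bar R}).
Variables (S : set (T1 * T2)) (F : T1 * T2 -> \bar R).
Hypotheses (mS : measurable S) (mF : measurable_fun S F)
  (F0 : forall z, S z -> (0 <= F z)%E).

Let mFS : measurable_fun setT (F \_ S).
Proof. by apply/(measurable_restrictT F mS). Qed.

Let FS0 z : (0 <= (F \_ S) z)%E.
Proof. by rewrite patchE; case: ifPn => //; rewrite inE; exact: F0. Qed.

Let xsecE x : (\int[m2]_(y in xsection S x) F (x, y) = \int[m2]_y (F \_ S) (x, y))%E.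
Proof.
rewrite integral_mkcond; apply: eq_integral => y _.
by rewrite !patchE mem_xsection.
Qed.

Let ysecE y : (\int[m1]_(x in ysection S y) F (x, y) = \int[m1]_x (F \_ S) (x, y))%E.
Proof.
rewrite integral_mkcond; apply: eq_integral => x _.
by rewrite !patchE mem_ysection.
Qed.

Lemma measurable_integral_xsection :
  measurable_fun setT (fun x => \int[m2]_(y in xsection S x) F (x, y))%E.
Proof.
by under eq_fun do rewrite xsecE; exact: measurable_fun_fubini_tonelli_F.
Qed.

Lemma measurable_integral_ysection :
  measurable_fun setT (fun y => \int[m1]_(x in ysection S y) F (x, y))%E.
Proof.
by under eq_fun do rewrite ysecE; exact: measurable_fun_fubini_tonelli_G.
Qed.

Lemma integral_xsection : (\int[m1 \x m2]_(z in S) F z =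
  \int[m1]_x \int[m2]_(y in xsection S x) F (x, y))%E.
Proof.
rewrite integral_mkcond (fubini_tonelli1 _ mFS FS0); apply: eq_integral => x _.
by rewrite xsecE.
Qed.

Lemma integral_ysection : (\int[m1 \x m2]_(z in S) F z =
  \int[m2]_y \int[m1]_(x in ysection S y) F (x, y))%E.
Proof.
rewrite integral_mkcond (fubini_tonelli1 _ mFS FS0) (fubini_tonelli _ mFS FS0).
by apply: eq_integral => y _; rewrite ysecE.
Qed.
End tonelli_sections.

(** * Integrals along expanding maps *)

Section profile.
Context {R : realType}.
Local Notation mu := (@lebesgue_measure R).
Implicit Types (f g e q Q : R -> R).

Definition expanding (D : set R) e :=
  forall x y, D x -> D y -> x <= y -> y - x <= e y - e x.

(** An expanding map is increasing, so it pulls rays back to intervals. *)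
Lemma measurable_expanding (D : set R) e : is_interval D -> expanding D e -> measurable_fun D e.
Proof.
move=> iD ee; have mD : measurable D by exact: is_interval_measurable.
apply: (measurability (@RGenCInfty.G R)) => [|/= _ [_] [r] -> <-].
  exact: RGenCInfty.measurableE.
apply: is_interval_measurable => s t /= [Ds rs] [Dt rt] u /andP[su ut].
have Du : D u by apply: (iD s t) => //; rewrite su ut.
split => //=.
move: rs; rewrite /= !in_itv/= !andbT => /le_trans; apply.
by rewrite -subr_ge0 (le_trans _ (ee _ _ Ds Du su))// subr_ge0.
Qed.

(* A set of measure [l] is, up to a null set, the range of an expanding map on [`]0, l[], so a
   profile bounds the integrals of the decreasing rearrangement of [f]. *)
Definition profile f Q := forall (l : R) e, 0 <= l -> expanding `]0, l[ e ->
  (\int[mu]_(x in `]0%R, l[) (f (e x))%:E <= (Q l)%:E)%E.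

Section step.
Variables (e q : R -> R) (m b s : R).
Hypotheses (em : expanding `]0, m[ e) (qb : expanding `]0, b[ q).
Hypothesis sk : 0 < s < Num.min m b.

(* The L-shaped path through the corner (s, s) of the rectangle ]0, m[ x ]0, b[,
   along which the difference e alpha - q v is again expanding. *)
Definition hook (x : R) := if x < b - s then e s - q (b - x) else e (x - (b - s) + s) - q s.

Let s0 : 0 < s. Proof. by case/andP: sk. Qed.
Let sm : s < m. Proof. by case/andP: sk => _; rewrite lt_min => /andP[]. Qed.
Let sb : s < b. Proof. by case/andP: sk => _; rewrite lt_min => /andP[]. Qed.

(** On the first leg [v = b - x] decreases towards [s], so [- q v] grows at least as fast as [x]; on
    the second leg [e] does. Across the corner the two increments add up. *)
Lemma expanding_hook : expanding `]0, (m + b - 2 * s)[ hook.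
Proof.
move=> x y /=; rewrite !in_itv/= => /andP[x0 xl] /andP[y0 yl] xy.
move: (s0) (sm) (sb) => s0' sm' sb'.
have eh (u v : R) : 0 < u -> u <= v -> v < m -> v - u <= e v - e u.
  by move=> *; apply: em => //=; rewrite in_itv/=; apply/andP; split; lra.
have qh (u v : R) : 0 < u -> u <= v -> v < b -> v - u <= q v - q u.
  by move=> *; apply: qb => //=; rewrite in_itv/=; apply/andP; split; lra.
rewrite /hook; have [ys|ys] := ltP y (b - s).
  rewrite (le_lt_trans xy ys).
  by have := @qh (b - y) (b - x) ltac:(lra) ltac:(lra) ltac:(lra); lra.
have [xs|xs] := ltP x (b - s).
  have := @qh s (b - x) ltac:(lra) ltac:(lra) ltac:(lra).
  by have := @eh s (y - (b - s) + s) ltac:(lra) ltac:(lra) ltac:(lra); lra.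
by have := @eh (x - (b - s) + s) (y - (b - s) + s) ltac:(lra) ltac:(lra) ltac:(lra); lra.
Qed.

Lemma integral_hook f : measurable_fun setT f -> (forall x, 0 <= f x) ->
  (\int[mu]_(x in `]0%R, (m + b - 2 * s)%R[) (f (hook x))%:E =
   \int[mu]_(v in `]s, b[) (f (e s - q v)%R)%:E +
   \int[mu]_(x in `[s, m[) (f (e x - q s)%R)%:E)%E.
Proof.
move=> mf f0; move: (s0) (sm) (sb) => s0' sm' sb'.
have itvS u v w : u < v -> v < w -> (`]u, w[%classic : set R) = `]u, v[ `|` `[v, w[.
  by move=> uv vw; rewrite -itv_bndbnd_setU// bnd_simp ltW.
have bs0 : 0 < b - s by rewrite subr_gt0.
have bsm : b - s < m + b - 2 * s by move: sm; lra.
rewrite (itvS _ _ _ bs0 bsm).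
have mhook : measurable_fun (`]0, (m + b - 2 * s)[%classic : set R) (fun x => (f (hook x))%:E).
  apply/measurable_EFinP; apply: (measurableT_comp mf).
  by apply: measurable_expanding expanding_hook; exact: interval_is_interval.
rewrite ge0_integral_setU//=; last 3 first.
- by rewrite -(itvS _ _ _ bs0 bsm).
- by move=> x _; rewrite lee_fin.
- apply/disj_setPS => x [] /=; rewrite !in_itv/= => /andP[_ xc] /andP[cx _].
  by move: xc; rewrite ltNge cx.
congr (_ + _)%E.
- rewrite (@ge0_integral_affine R (-1) b `]s, b[%classic)//; last 2 first.
  + apply/measurable_EFinP; apply: (measurableT_comp mf); apply: measurable_funB => //.
    apply: (@measurable_funS _ _ _ _ `]0, b[%classic) => //.
      by apply: subset_itvr; rewrite bnd_simp ltW.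
    by apply: measurable_expanding qb; exact: interval_is_interval.
  + by move=> x _; rewrite lee_fin.
  rewrite normrN1 mul1e (_ : _ @^-1` _ = `]0, (b - s)[%classic); last first.
    by apply/seteqP; split => x /=; rewrite !in_itv/= => /andP[? ?]; apply/andP; split; lra.
  apply: eq_integral => x; rewrite inE/= in_itv/= => /andP[x0 xb].
  by rewrite /hook xb mulN1r [- x + b]addrC.
- rewrite (@ge0_integral_affine R 1 (- (b - s) + s) `[s, m[%classic)//; last 2 first.
  + apply/measurable_EFinP; apply: (measurableT_comp mf); apply: measurable_funB => //.
    apply: (@measurable_funS _ _ _ _ `]0, m[%classic) => //.
      by apply: subset_itvr; rewrite bnd_simp.
    by apply: measurable_expanding em; exact: interval_is_interval.
  + by move=> x _; rewrite lee_fin.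
  rewrite normr1 mul1e (_ : _ @^-1` _ = `[(b - s), (m + b - 2 * s)[%classic); last first.
    by apply/seteqP; split => x /=; rewrite !in_itv/= => /andP[? ?]; apply/andP; split; lra.
  apply: eq_integral => x; rewrite inE/= in_itv/= => /andP[xb xl].
  by rewrite /hook ltNge xb/= mul1r addrA.
Qed.
End step.

(* The rectangle [`]0, m[ `*` `]0, b[] is cut along its diagonal into horizontal and vertical
   segments, which are matched into the hooks of [expanding_hook], of length [m + b - 2 * s]. *)
Lemma profile_step f g q b Q Q' : 0 < b -> measurable_fun setT f -> (forall x, 0 <= f x) ->
  expanding `]0, b[ q ->
  (forall x, (g x)%:E = (b^-1)%:E * \int[mu]_(v in `]0%R, b[) (f (x - q v)%R)%:E)%E ->
  profile f Q ->
  (forall m, 0 <= m -> measurable_fun (`]0, (Num.min m b)[%classic : set R) (fun s => Q (m + b - 2 * s)) /\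
     ((b^-1)%:E * \int[mu]_(s in `]0%R, (Num.min m b)[) (Q (m + b - 2 * s)%R)%:E <= (Q' m)%:E)%E) ->
  profile g Q'.
Proof.
move=> b0 mf f0 qb gE fQ QQ' m e m0 em.
have [mQ] := QQ' m m0; apply: le_trans.
pose A : set R := `]0, m[%classic; pose B : set R := `]0, b[%classic; pose k := Num.min m b.
pose F (z : R * R) := (f (e z.1 - q z.2))%:E.
have mA : measurable A by exact: measurable_itv.
have mB : measurable B by exact: measurable_itv.
have mAB : measurable (A `*` B) by exact: measurableX.
have mF : measurable_fun (A `*` B) F.
  apply/measurable_EFinP; apply: (measurableT_comp mf); apply: measurable_funB.
    apply: (@measurable_comp _ _ _ _ _ _ A) => //=.
    - by move=> _ [z [Az _] <-].
    - by apply: measurable_expanding em; exact: interval_is_interval.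
    - exact: measurable_funTS.
  apply: (@measurable_comp _ _ _ _ _ _ B) => //=.
  - by move=> _ [z [_ Bz] <-].
  - by apply: measurable_expanding qb; exact: interval_is_interval.
  - exact: measurable_funTS.
have F0 z : (0 <= F z)%E by rewrite lee_fin.
pose L : set (R * R) := [set z | z.1 < z.2].
have mL : measurable L.
  have := @measurable_fun_ltr _ _ _ setT (@fst R R) (@snd R R) measurable_fst measurable_snd.
  move=> /(_ measurableT [set true]) h; rewrite (_ : L = setT `&` (fun z => z.1 < z.2) @^-1` [set true]).
    by apply: h.
  by rewrite setTI; apply/seteqP; split => z /=.
(* [S1] is sliced at fixed first coordinate and [S2] at fixed second coordinate, so both are indexed
   by the corner [(s, s)] of a hook, with [s] below [k]. The diagonal goes to [S2], whence the
   closed end of [[s, m[]. *)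
pose S1 := (A `*` B) `&` L; pose S2 := (A `*` B) `\` L.
have mS1 : measurable S1 by exact: measurableI.
have mS2 : measurable S2 by exact: measurableD.
have mF1 : measurable_fun S1 F by apply: measurable_funS mF => // z [].
have mF2 : measurable_fun S2 F by apply: measurable_funS mF => // z [].
have xAB x : A x -> xsection (A `*` B) x = B by move=> Ax; rewrite in_xsectionX// inE.
have rect : (\int[mu]_(x in A) (g (e x))%:E = (b^-1)%:E * \int[mu \x mu]_(z in A `*` B) F z)%E.
  have -> : (\int[mu \x mu]_(z in A `*` B) F z = \int[mu]_(x in A) \int[mu]_(y in B) F (x, y))%E.
    apply: etrans (integral_xsection mu mu mAB mF (fun z _ => F0 z)) _.
    rewrite [RHS]integral_mkcond; apply: eq_integral => x _.
    rewrite patchE; case: ifPn => xA; first by rewrite in_xsectionX.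
    by rewrite notin_xsectionX// integral_set0.
  rewrite -ge0_integralZl//=.
  - by apply: eq_integral => x _; rewrite gE.
  - have := measurable_integral_xsection mu mAB mF (fun z _ => F0 z).
    move=> /(measurable_funS measurableT (@subsetT _ A)).
    by apply: eq_measurable_fun => x /[!inE] Ax; rewrite xAB.
  - by move=> x _; apply: integral_ge0 => v _; rewrite lee_fin.
  - by rewrite lee_fin invr_ge0 ltW.
rewrite rect; apply: lee_wpmul2l; first by rewrite lee_fin invr_ge0 ltW.
have k0 s : `]0, k[%classic s -> [/\ 0 < s, s < m & s < b].
  by rewrite /= in_itv/= lt_min => /and3P[].
have xS1 x : xsection S1 x = if x \in `]0, k[ then `]x, b[%classic else set0.
  apply/seteqP; split => y; rewrite /xsection/= inE.
    move=> [[/= Ax By] xy]; move: Ax By; rewrite /A /B/= !in_itv/= lt_min.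
    by move=> /andP[-> ->] /andP[y0 yb]; rewrite (lt_trans xy yb)/= in_itv/= yb andbT.
  case: ifPn => //; rewrite in_itv/= lt_min => /and3P[x0 xm xb]; rewrite /= in_itv/= => /andP[xy yb].
  by split => //; split; rewrite /A /B/= in_itv/= ?x0 ?xm ?yb ?(lt_trans x0 xy).
have yS2 y : ysection S2 y = if y \in `]0, k[ then `[y, m[%classic else set0.
  apply/seteqP; split => x; rewrite /ysection/= inE.
    move=> [[/= Ax By] /negP]; move: Ax By; rewrite /A /B/= !in_itv/= lt_min -leNgt.
    by move=> /andP[x0 xm] /andP[-> ->] yx; rewrite (le_lt_trans yx xm)/= in_itv/= xm andbT.
  case: ifPn => //; rewrite in_itv/= lt_min => /and3P[y0 ym yb]; rewrite /= in_itv/= => /andP[yx xm].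
  split; last by apply/negP; rewrite -leNgt.
  by split; rewrite /A /B/= in_itv/= ?y0 ?yb ?xm ?(lt_le_trans y0 yx).
have -> : A `*` B = S1 `|` S2 by rewrite /S1 /S2 setUIDK.
have mF12 : measurable_fun (S1 `|` S2) F by rewrite /S1 /S2 setUIDK.
rewrite ge0_integral_setU//; last first.
  by apply/disj_setPS => z [[_ Lz] [_ nLz]].
rewrite (integral_xsection mu mu mS1 mF1 (fun z _ => F0 z)).
rewrite (integral_ysection mu mu mS2 mF2 (fun z _ => F0 z)).
have I1 : (\int[mu]_x \int[mu]_(y in xsection S1 x) F (x, y) =
    \int[mu]_(s in `]0%R, k[) \int[mu]_(v in `]s, b[) (f (e s - q v)%R)%:E)%E.
  rewrite [RHS]integral_mkcond; apply: eq_integral => x _.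
  by rewrite xS1 patchE mem_setE; case: ifPn => // _; rewrite integral_set0.
have I2 : (\int[mu]_y \int[mu]_(x in ysection S2 y) F (x, y) =
    \int[mu]_(s in `]0%R, k[) \int[mu]_(x in `[s, m[) (f (e x - q s)%R)%:E)%E.
  rewrite [RHS]integral_mkcond; apply: eq_integral => y _.
  by rewrite yS2 patchE mem_setE; case: ifPn => // _; rewrite integral_set0.
rewrite I1 I2.
have m1 : measurable_fun (`]0, k[%classic : set R) (fun s => \int[mu]_(v in `]s, b[) (f (e s - q v)%R)%:E)%E.
  have := measurable_integral_xsection mu mS1 mF1 (fun z _ => F0 z).
  move=> /(measurable_funS measurableT (@subsetT _ `]0, k[%classic)).
  by apply: eq_measurable_fun => x /[!inE] xk; rewrite xS1 ifT.
have m2 : measurable_fun (`]0, k[%classic : set R) (fun s => \int[mu]_(x in `[s, m[) (f (e x - q s)%R)%:E)%E.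
  have := measurable_integral_ysection mu mS2 mF2 (fun z _ => F0 z).
  move=> /(measurable_funS measurableT (@subsetT _ `]0, k[%classic)).
  by apply: eq_measurable_fun => x /[!inE] xk; rewrite yS2 ifT.
have p1 s : (0 <= \int[mu]_(v in `]s, b[) (f (e s - q v)%R)%:E)%E.
  by apply: integral_ge0 => v _; rewrite lee_fin.
have p2 s : (0 <= \int[mu]_(x in `[s, m[) (f (e x - q s)%R)%:E)%E.
  by apply: integral_ge0 => v _; rewrite lee_fin.
have mk : measurable (`]0, k[%classic : set R) by exact: measurable_itv.
rewrite -(ge0_integralD mu mk (fun s _ => p1 s) m1 (fun s _ => p2 s) m2).
apply: ge0_le_integral; [exact: mk| | | |].
- by move=> s _; exact: adde_ge0.
- exact: emeasurable_funD.
- exact/measurable_EFinP.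
- move=> s sk; have [s0 sm sb] := k0 s sk.
  have sk' : 0 < s < Num.min m b by move: sk; rewrite /= in_itv.
  rewrite -(integral_hook em qb sk' mf f0).
  apply: fQ; first by clear -s0 sm sb; lra.
  exact: expanding_hook.
Qed.

End profile.

(** * Fubini's theorem on a rectangle *)

Section fubini_on.
Context d1 d2 (T1 : measurableType d1) (T2 : measurableType d2) (R : realType).
Variables (m1 : {sigma_finite_measure set T1 -> \bar R})
  (m2 : {sigma_finite_measure set T2 -> \bar R}).
Variables (D : set T1) (E : set T2) (f : T1 * T2 -> R).
Hypotheses (mD : measurable D) (mE : measurable E) (mf : measurable_fun (D `*` E) f).
Hypothesis f_int : (\int[m1]_(x in D) \int[m2]_(y in E) `|f (x, y)|%:E < +oo)%E.

Let g := (EFin \o f) \_ (D `*` E).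

Let mg : measurable_fun setT g.
Proof. by apply/(measurable_restrictT _ (measurableX mD mE)); exact/measurable_EFinP. Qed.

Let gx x : D x -> (\int[m2]_y g (x, y) = \int[m2]_(y in E) (f (x, y))%:E)%E.
Proof.
move=> Dx; rewrite [RHS]integral_mkcond; apply: eq_integral => y _.
by rewrite /g !patchE in_setX/= mem_set.
Qed.

Let gx0 x : ~ D x -> (\int[m2]_y g (x, y) = 0)%E.
Proof. by move=> Dx; apply: integral0_eq => y _; rewrite /g patchE in_setX/= memNset. Qed.

Let gy y : E y -> (\int[m1]_x g (x, y) = \int[m1]_(x in D) (f (x, y))%:E)%E.
Proof.
move=> Ey; rewrite [RHS]integral_mkcond; apply: eq_integral => x _.
by rewrite /g !patchE in_setX/= (mem_set Ey) andbT.
Qed.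

Let gy0 y : ~ E y -> (\int[m1]_x g (x, y) = 0)%E.
Proof. by move=> Ey; apply: integral0_eq => x _; rewrite /g patchE in_setX/= (memNset Ey) andbF. Qed.

Let ig : (m1 \x m2)%E.-integrable setT g.
Proof.
have [_] := integrable12ltyP m1 m2 mg; apply; apply: le_lt_trans f_int.
rewrite [leRHS]integral_mkcond le_eqVlt; apply/orP; left; apply/eqP.
apply: eq_integral => x _; rewrite patchE; case: ifPn => [/[!inE] Dx|].
  rewrite [RHS]integral_mkcond; apply: eq_integral => y _.
  by rewrite /g !patchE in_setX/= mem_set//=; case: (y \in E) => //=; exact: abse0.
rewrite notin_setE => nDx; apply: integral0_eq => y _.
by rewrite /g patchE in_setX/= memNset//=; exact: abse0.
Qed.

Lemma fubini_on : (\int[m1]_(x in D) \int[m2]_(y in E) (f (x, y))%:E =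
  \int[m2]_(y in E) \int[m1]_(x in D) (f (x, y))%:E)%E.
Proof.
apply: etrans (etrans (Fubini ig) _).
  rewrite [LHS]integral_mkcond; apply: eq_integral => x _; rewrite patchE.
  by case: ifPn => [/[!inE]/gx//|]; rewrite notin_setE => /gx0.
rewrite [RHS]integral_mkcond; apply: eq_integral => y _; rewrite patchE.
by case: ifPn => [/[!inE]/gy//|]; rewrite notin_setE => /gy0.
Qed.

Lemma measurable_fubini_on :
  measurable_fun D (fun x => \int[m2]_(y in E) (f (x, y))%:E)%E.
Proof.
have := measurable_fubini_F ig => /(measurable_funS measurableT (@subsetT _ D)).
by apply: eq_measurable_fun => x /[!inE] Dx; rewrite /fubini_F gx.
Qed.
End fubini_on.

(** * The Fourier integral for sums of uniform variables *)

Section fourier_profile.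
Context {R : realType}.
Local Notation mu := (@lebesgue_measure R).
Implicit Types (c b l m t s : R) (w : R -> R).

Lemma FTC_itv (F f : R -> R) k : 0 <= k -> continuous f ->
  (forall x : R, is_derive x 1 F (f x)) ->
  (\int[mu]_(x in `]0%R, k[) (f x)%:E = (F k - F 0)%:E)%E.
Proof.
rewrite le_eqVlt => /predU1P[<- _ _|k0 cf dF].
  by rewrite set_itvoo0// integral_set0 subrr.
have mf : measurable_fun setT f by exact: continuous_measurable_fun.
rewrite -(@integral_itv_bndoo _ _ _ _ true false); last exact/measurable_EFinP/measurable_funTS.
have cF (x : R) : {for x, continuous F}.
  by have h := dF x; apply: differentiable_continuous; apply/derivable1_diffP.
rewrite (@continuous_FTC2 _ f F)//.
- exact: continuous_subspaceT.
- split => //.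
  + by apply: cvg_at_right_filter; exact: cF.
  + by apply: cvg_at_left_filter; exact: cF.
- by move=> x _; have h := dF x; rewrite derive1E derive_val.
Qed.

Definition fp_kernel c w l t : R := l * sinc (l * t) * sinc (c * t) * w t.

(* When [w t] is the product of the [sinc (b_i * t)], this is, by Fourier inversion, the integral
   over [[-l/2, l/2]] of [x |-> P (`|x + U| <= c / 2)], where [U] is a sum of independent variables
   uniform on the intervals [[-b_i/2, b_i/2]]. *)
Definition fourier_profile c w l : R :=
  2 / pi * c * \int[mu]_(t in `]0%R, +oo[) fp_kernel c w l t.

(** The absolute value matters: with [a = (l - c) / 2] it is the source of the minimum in
    [fourier_profile1]. *)
Lemma integral_sinc_sqr (a : R) :
  (\int[mu]_(t in `]0%R, +oo[) ((a * sinc (a * t)) ^+ 2)%:E = (`|a| * (pi / 2))%:E)%E.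
Proof.
wlog a0 : a / 0 < a => [H|].
  have [a0|a0|a0] := ltgtP 0 a; first exact: H.
    have := H (- a); rewrite oppr_gt0 => /(_ a0); rewrite normrN => <-.
    by apply: eq_integral => t _; rewrite (mulNr a t) sincN mulNr sqrrN.
  by rewrite -a0 normr0 mul0r integral0_eq// => t _; rewrite mul0r expr0n.
have ms : measurable_fun setT (fun t : R => sinc t ^+ 2).
  by apply: measurable_funX; exact: measurable_sinc.
have := @integral_sinc2 R.
rewrite (@ge0_integral_affine R a 0)//; last 3 first.
- by rewrite gt_eqF.
- exact/measurable_EFinP/measurable_funTS.
- by move=> x _; rewrite lee_fin sqr_ge0.
have -> : (fun t : R => a * t + 0) @^-1` `]0, +oo[%classic = `]0, +oo[%classic.
  by apply/seteqP; split => x /=; rewrite !in_itv/= !andbT addr0 pmulr_rgt0.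
under eq_integral do rewrite addr0.
move=> h; under eq_integral do rewrite exprMn EFinM.
rewrite ge0_integralZl//=.
- by rewrite expr2 EFinM -muleA -{2}(gtr0_norm a0) h -EFinM gtr0_norm.
- apply/measurable_EFinP/measurable_funTS; apply: (measurableT_comp ms).
  exact: measurable_funM.
- by move=> x _; rewrite lee_fin sqr_ge0.
- by rewrite lee_fin sqr_ge0.
Qed.

Variables (c : R) (w : R -> R).
Hypotheses (c0 : 0 < c) (mw : measurable_fun setT w) (w1 : forall t, `|w t| <= 1).

(** An integrable majorant obtained from [x * y <= x ^+ 2 + y ^+ 2]. The second term is written with
    [c ^- 2] so that [integral_sinc_sqr] applies. Its integral is explicit in [l], which gives the
    uniformity needed for Fubini. *)
Definition fp_dom l t : R := (l * sinc (l * t)) ^+ 2 + c ^- 2 * (c * sinc (c * t)) ^+ 2.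

Lemma fp_kernel_le l t : `|fp_kernel c w l t| <= fp_dom l t.
Proof.
rewrite /fp_kernel normrM; apply: (@le_trans _ _ `|l * sinc (l * t) * sinc (c * t)|).
  by rewrite ler_piMr.
have -> : fp_dom l t = (l * sinc (l * t)) ^+ 2 + sinc (c * t) ^+ 2.
  by rewrite /fp_dom; field; rewrite gt_eqF.
rewrite normrM.
rewrite -(real_normK (num_real (l * _))) -(real_normK (num_real (sinc (c * t)))).
set x := `|l * _|; set y := `|sinc _|.
by have := sqr_ge0 (x - y); have := sqr_ge0 x; have := sqr_ge0 y; lra.
Qed.

Lemma measurable_fp_dom l : measurable_fun setT (fp_dom l).
Proof.
have ms a : measurable_fun setT (fun t : R => (a * sinc (a * t)) ^+ 2).
  apply: measurable_funX; apply: measurable_funM => //.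
  by apply: (measurableT_comp measurable_sinc); exact: measurable_funM.
by apply: measurable_funD => //; exact: measurable_funM.
Qed.

Lemma integral_fp_dom l :
  (\int[mu]_(t in `]0%R, +oo[) (fp_dom l t)%:E = (`|l| * (pi / 2) + c^-1 * (pi / 2))%:E)%E.
Proof.
have ms a : measurable_fun (`]0, +oo[%classic : set R) (fun t : R => (a * sinc (a * t)) ^+ 2).
  apply: measurable_funX; apply: measurable_funM => //; apply: measurable_funTS.
  by apply: (measurableT_comp measurable_sinc); exact: measurable_funM.
transitivity (\int[mu]_(t in `]0%R, +oo[) (1 * (l * sinc (l * t)) ^+ 2 + c ^- 2 * (c * sinc (c * t)) ^+ 2)%:E)%E.
  by apply: eq_integral => t _; rewrite mul1r.
rewrite ge0_integral_lin ?invr_ge0 ?sqr_ge0//=; last 2 first.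
- by move=> x _; rewrite sqr_ge0.
- by move=> x _; rewrite sqr_ge0.
rewrite !integral_sinc_sqr mul1e -EFinM -EFinD (gtr0_norm c0); congr EFin.
- by field; rewrite gt_eqF.
- exact: ms.
- exact: ms.
Qed.

Lemma measurable_fp_kernel : measurable_fun setT (fun z : R * R => fp_kernel c w z.1 z.2).
Proof.
apply: measurable_funM; last by apply: measurableT_comp.
apply: measurable_funM.
  apply: measurable_funM => //; apply: (measurableT_comp measurable_sinc).
  exact: measurable_funM.
apply: (measurableT_comp measurable_sinc); apply: measurable_funM => //.
Qed.

Lemma measurable_fp_kernel1 l : measurable_fun setT (fp_kernel c w l).
Proof. exact: (measurableT_comp measurable_fp_kernel (measurable_pair1 _ )). Qed.

Lemma integrable_fp_kernel l : mu.-integrable `]0, +oo[ (EFin \o fp_kernel c w l).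
Proof.
apply: (@le_integrable _ _ _ mu _ _ _ (EFin \o fp_dom l)) => //.
- apply/measurable_EFinP; apply: measurable_funTS; exact: measurable_fp_kernel1.
- by move=> t _ /=; rewrite lee_fin (le_trans (fp_kernel_le _ _))// ler_norm.
- apply/integrableP; split; first by apply/measurable_EFinP; apply: measurable_funTS; exact: measurable_fp_dom.
  under eq_integral => t _.
    rewrite /= (ger0_norm (le_trans (normr_ge0 _) (fp_kernel_le l t))).
    over.
  by rewrite /= integral_fp_dom ltry.
Qed.

Lemma fourier_profileE l : (fourier_profile c w l)%:E =
  ((2 / pi * c)%:E * \int[mu]_(t in `]0%R, +oo[) (fp_kernel c w l t)%:E)%E.
Proof.
rewrite /fourier_profile EFinM /Rintegral fineK//.
by apply: integrable_fin_num => //; exact: integrable_fp_kernel.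
Qed.

End fourier_profile.

Section fourier_profile_step.
Context {R : realType}.
Local Notation mu := (@lebesgue_measure R).
Implicit Types (c b l m t s : R) (w : R -> R).

(** As [l * sinc (l * t) = sin (l * t) / t], integrating over [l = m + b - 2 * s] gives a difference
    of cosines, equal to [sin (m * t) * sin (b * t) / t ^+ 2]. A new variable therefore multiplies
    the weight by [sinc (b * t)]. The majorant [fp_dom] justifies the exchange of integrals. *)
Lemma fourier_profile_step c w b m : 0 < c -> measurable_fun setT w ->
  (forall t, `|w t| <= 1) -> 0 < b -> 0 <= m ->
  measurable_fun (`]0, (Num.min m b)[%classic : set R) (fun s => fourier_profile c w (m + b - 2 * s)) /\
  ((b^-1)%:E * \int[mu]_(s in `]0%R, (Num.min m b)[) (fourier_profile c w (m + b - 2 * s)%R)%:E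
   = (fourier_profile c (fun t => w t * sinc (b * t)) m)%:E)%E.
Proof.
move=> c0 mw w1 b0 m0.
pose k := Num.min m b.
pose f (z : R * R) := fp_kernel c w (m + b - 2 * z.1) z.2.
pose D : set R := `]0, k[%classic; pose E : set R := `]0, +oo[%classic.
have mf : measurable_fun (D `*` E) f.
  apply: measurable_funTS.
  have ma : measurable_fun setT (fun z : R * R => m + b - 2 * z.1).
    by apply: measurable_funB => //; exact: measurable_funM.
  exact: (measurableT_comp (measurable_fp_kernel c mw) (measurable_fun_pair ma measurable_snd)).
have mD : measurable D by exact: measurable_itv.
have mE : measurable E by exact: measurable_itv.
have k0 : 0 <= k by rewrite le_min m0 ltW.
have fint : (\int[mu]_(x in D) \int[mu]_(y in E) `|f (x, y)|%:E < +oo)%E.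
  apply: (@le_lt_trans _ _ (\int[mu]_(x in D) ((m + b) * (pi / 2) + c^-1 * (pi / 2))%:E)%E).
    apply: ge0_le_integral; [exact: mD| | | |].
    - by move=> s _; apply: integral_ge0 => t _; rewrite lee_fin.
    - have mnf : measurable_fun (D `*` E) (fun z => `|f z|%:E).
        by apply/measurable_EFinP; exact: measurableT_comp.
      have := measurable_integral_xsection mu (measurableX mD mE) mnf (fun z _ => normr_ge0 (f z)).
      move=> /(measurable_funS measurableT (@subsetT _ D)).
      by apply: eq_measurable_fun => s Ds; rewrite in_xsectionX.
    - exact: measurable_cst.
    - move=> s; rewrite /D/= in_itv/= => /andP[s0 sk].
      have l0 : 0 <= m + b - 2 * s <= m + b.
        move: sk; rewrite /k lt_min => /andP[sm sb].
        by apply/andP; split; lra.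
      apply: (@le_trans _ _ (\int[mu]_(t in E) (fp_dom c (m + b - 2 * s) t)%:E)%E).
        apply: ge0_le_integral; [exact: mE| | | |].
        + by move=> t _; rewrite lee_fin.
        + apply/measurable_EFinP; apply: measurableT_comp => //; apply: measurable_funTS.
          exact: (measurable_fp_kernel1 c mw (m + b - 2 * s)).
        + by apply/measurable_EFinP; apply: measurable_funTS; exact: measurable_fp_dom.
        + by move=> t _; rewrite lee_fin; exact: fp_kernel_le.
      rewrite (integral_fp_dom c0) lee_fin lerD2r ler_wpM2r ?divr_ge0 ?pi_ge0//.
      by rewrite ger0_norm; case/andP: l0.
  rewrite integral_cst//= lebesgue_measure_itv/=; case: ifPn => _.
    by rewrite -EFinB -EFinM ltry.
  by rewrite mule0 ltry.
have mQ : measurable_fun D (fun s => (fourier_profile c w (m + b - 2 * s))%:E).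
  have := (@measurable_fubini_on _ _ _ _ _ mu mu D E f mD mE mf fint).
  move=> h; under eq_fun do rewrite (fourier_profileE c0 mw w1).
  exact: measurable_funeM.
split; first exact/measurable_EFinP.
under eq_integral do rewrite (fourier_profileE c0 mw w1).
pose w' t := w t * sinc (b * t).
have mw' : measurable_fun setT w'.
  apply: measurable_funM => //; apply: (measurableT_comp measurable_sinc).
  exact: measurable_funM.
have w1' t : `|w' t| <= 1.
  by rewrite normrM mulr_ile1// normr_sinc_le1.
rewrite integralZl//=; last first.
  apply/integrableP; split; first exact: (@measurable_fubini_on _ _ _ _ _ mu mu D E f mD mE mf fint).
  apply: (le_lt_trans _ fint); apply: ge0_le_integral; [exact: mD| | | |].
  - by move=> s _; exact: abse_ge0.
  - by apply: measurableT_comp => //; exact: (@measurable_fubini_on _ _ _ _ _ mu mu D E f mD mE mf fint).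
  - have mnf : measurable_fun (D `*` E) (fun z => `|f z|%:E).
      by apply/measurable_EFinP; exact: measurableT_comp.
    have := measurable_integral_xsection mu (measurableX mD mE) mnf (fun z _ => normr_ge0 (f z)).
    move=> /(measurable_funS measurableT (@subsetT _ D)).
    by apply: eq_measurable_fun => s Ds; rewrite in_xsectionX.
  - move=> s _; apply: le_abse_integral => //.
    by have /measurable_int := integrable_fp_kernel c0 mw w1 (m + b - 2 * s).
rewrite (@fubini_on _ _ _ _ _ mu mu D E f mD mE mf fint).
have inner t : E t -> (\int[mu]_(s in D) (f (s, t))%:E = (b * fp_kernel c w' m t)%:E)%E.
  rewrite /E/= in_itv/= andbT => t0.
  have tn0 : t != 0 by rewrite gt_eqF.
  have sincE l : l * sinc (l * t) = sin (l * t) / t.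
    by rewrite -sincM; field.
  pose F (s : R) := cos ((m + b - 2 * s) * t) / (2 * t ^+ 2) * (sinc (c * t) * w t).
  pose F' (s : R) := sin ((m + b - 2 * s) * t) / t * (sinc (c * t) * w t).
  have dF (s : R) : is_derive s 1 F (F' s) by rewrite /F /F'; der_eq => /=; field.
  have cF : continuous F' by apply: deriv_continuous => s; eexists; rewrite /F'; der.
  have fE s : f (s, t) = F' s.
    by rewrite /f /fp_kernel/= sincE -mulrA.
  under eq_integral do rewrite fE.
  apply: etrans (FTC_itv k0 cF dF) _; congr EFin.
  have -> : F k - F 0 = (cos (m * t - b * t) - cos (m * t + b * t)) / (2 * t ^+ 2) * (sinc (c * t) * w t).
    rewrite /F mulr0 subr0 -mulrBl -mulrBl; congr ((_ - _) / _ * _).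
      (* At [s = k] the length [m + b - 2 * s] is the distance between [m] and [b]; the order of the
         two is immaterial since the cosine is even. *)
      rewrite /k; have [mb|bm] := leP m b.
        by rewrite -cosN; congr cos; ring.
      by congr cos; ring.
    by congr cos; ring.
  rewrite cosB cosD /fp_kernel /w' sincE.
  have -> : b * (sin (m * t) / t * sinc (c * t) * (w t * sinc (b * t))) =
    sin (m * t) / t * sinc (c * t) * w t * (b * sinc (b * t)) by ring.
  by rewrite sincE; field.
transitivity ((b^-1)%:E * ((2 / pi * c)%:E * \int[mu]_(t in E) (b%:E * (fp_kernel c w' m t)%:E)))%E.
  congr (_ * (_ * _))%E; apply: eq_integral => t /[!inE] Et.
  by rewrite inner// EFinM.
rewrite integralZl//; last exact: integrable_fp_kernel.
rewrite (fourier_profileE c0 mw' w1') muleCA; congr (_ * _)%E.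
by rewrite muleA -EFinM mulVf ?gt_eqF// mul1e.
Qed.
End fourier_profile_step.

(** * Initial profile and final estimate *)

Section profile_bounds.
Context {R : realType}.
Local Notation mu := (@lebesgue_measure R).
Implicit Types (c b l m t s : R) (f g q w : R -> R).

Lemma le_profile f Q Q' : (forall l, 0 <= l -> Q l <= Q' l) -> profile f Q -> profile f Q'.
Proof.
move=> QQ' fQ l e l0 el; apply: le_trans (fQ l e l0 el) _.
by rewrite lee_fin QQ'.
Qed.

Definition window (y c x : R) : R := \1_(`[y, y + c]%classic : set R) x.

(** Two points of [E] have images in an interval of length [c], hence are themselves at distance at
    most [c]. So [E] lies in an interval of length [c] starting at its infimum. *)
Lemma profile_window y c : 0 <= c -> profile (window y c) (fun l => Num.min l c).
Proof.
move=> c0 l e l0 el.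
pose E : set R := `]0, l[%classic `&` e @^-1` `[y, y + c]%classic.
have me : measurable_fun (`]0, l[%classic : set R) e.
  by apply: measurable_expanding el; exact: interval_is_interval.
have mE : measurable E by apply: me.
have -> : (\int[mu]_(x in `]0%R, l[) (window y c (e x))%:E = mu E)%E.
  transitivity (\int[mu]_(x in `]0%R, l[) (\1_E x)%:E)%E.
    by apply: eq_integral => x xl; rewrite /window !indicE in_setI xl.
  by rewrite integral_indic// setIC setIA setIid.
have El : E `<=` `]0, l[%classic by move=> x [].
have [->|/set0P[x0 Ex0]] := eqVneq E set0.
  by rewrite measure0 lee_fin le_min l0 c0.
have Elb x : E x -> forall z, E z -> x - c <= z.
  move=> [xl /=]; rewrite in_itv/= => /andP[_ xy] z [zl /=]; rewrite in_itv/= => /andP[yz _].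
  have [zx|xz] := leP z x; last by lra.
  have := el z x zl xl zx; lra.
have hE : has_inf E.
  by split; [exists x0|exists (x0 - c) => z Ez; exact: Elb].
have Ec : E `<=` `[inf E, (inf E + c)]%classic.
  move=> x Ex /=; rewrite in_itv/=; apply/andP; split.
    by apply: ge_inf => //; exact: hE.2.
  rewrite -lerBlDr; apply: lb_le_inf; first exact: hE.1.
  by move=> z Ez; exact: Elb.
rewrite EFin_min le_min; apply/andP; split.
  apply: (@le_trans _ _ (mu (`]0, l[%classic : set R))).
    exact: (le_measure mu (mem_set mE) (mem_set (measurable_itv _)) El).
  by rewrite lebesgue_measure_itv/= lte_fin; case: ifPn; rewrite ?sube0// -EFinB subr0.
apply: (@le_trans _ _ (mu (`[inf E, (inf E + c)]%classic : set R))).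
  exact: (le_measure mu (mem_set mE) (mem_set (measurable_itv _)) Ec).
rewrite lebesgue_measure_itv/= lte_fin; case: ifPn; last by rewrite lee_fin.
by rewrite -EFinB addrAC subrr add0r.
Qed.

(** Here [sin (A + B) * sin (A - B) = sin A ^+ 2 - sin B ^+ 2] reduces the integral to two squares.
    The value is half of [l + c] minus the distance of [l] and [c], which is the minimum exactly. *)
Lemma fourier_profile1 c l : 0 < c -> 0 <= l -> Num.min l c <= fourier_profile c (fun=> 1) l.
Proof.
move=> c0 l0.
have w1 (t : R) : `|1 : R| <= 1 by rewrite normr1.
rewrite -lee_fin (fourier_profileE c0 (measurable_cst _) w1).
have ms (a : R) : measurable_fun (`]0, +oo[%classic : set R) (fun t : R => (a * sinc (a * t)) ^+ 2).
  apply: measurable_funX; apply: measurable_funM => //; apply: measurable_funTS.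
  by apply: (measurableT_comp measurable_sinc); exact: measurable_funM.
have is_ (a : R) : mu.-integrable `]0, +oo[ (fun t => ((a * sinc (a * t)) ^+ 2)%:E).
  apply/integrableP; split; first by apply/measurable_EFinP; exact: ms.
  under eq_integral do rewrite gee0_abs ?lee_fin ?sqr_ge0//.
  by rewrite integral_sinc_sqr ltry.
have -> : (\int[mu]_(t in `]0%R, +oo[) (fp_kernel c (fun=> 1) l t)%:E =
   (c^-1)%:E * \int[mu]_(t in `]0%R, +oo[) ((((l + c) / 2 * sinc ((l + c) / 2 * t)) ^+ 2)%:E
     - (((l - c) / 2 * sinc ((l - c) / 2 * t)) ^+ 2)%:E))%E.
  rewrite -integralZl//; last by apply: integrableB.
  apply: eq_integral => t; rewrite inE/= in_itv/= andbT => t0.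
  rewrite -EFinB -EFinM; congr EFin.
  have sincE (a : R) : a * sinc (a * t) = sin (a * t) / t.
    by rewrite -sincM; field; rewrite gt_eqF.
  rewrite /fp_kernel mulr1 !sincE.
  have -> : sin (l * t) / t * sinc (c * t) = c^-1 * (sin (l * t) / t * (c * sinc (c * t))).
    by field; rewrite !gt_eqF.
  rewrite sincE.
  set A := (l + c) / 2 * t; set B := (l - c) / 2 * t.
  have -> : l * t = A + B by rewrite /A /B; field.
  have -> : c * t = A - B by rewrite /A /B; field.
  rewrite sinD sinB; congr (_ * _).
  have hA := cos2Dsin2 A; have hB := cos2Dsin2 B.
  have -> : (sin A / t) ^+ 2 - (sin B / t) ^+ 2 =
     (sin A ^+ 2 * (cos B ^+ 2 + sin B ^+ 2) - sin B ^+ 2 * (cos A ^+ 2 + sin A ^+ 2)) / t ^+ 2.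
    by rewrite hA hB; field; rewrite gt_eqF.
  by field; rewrite gt_eqF.
rewrite integralB//= !integral_sinc_sqr -EFinB -!EFinM lee_fin.
have pi0 := @pi_gt0 R.
have cancel (p X Y : R) : 0 < p -> 2 / p * c * (c^-1 * (X * (p / 2) - Y * (p / 2))) = X - Y.
  by move=> p0; field; rewrite !gt_eqF.
rewrite cancel//.
rewrite [X in X - _]ger0_norm; last by rewrite divr_ge0// addr_ge0// ltW.
clear - c0 l0; have [lc|cl] := leP l c.
  by rewrite ler0_norm; lra.
by rewrite gtr0_norm; lra.
Qed.

(** Both cardinal sines of the kernel are bounded by 1. What remains is proportional to [c * l], the
    form required by [law_bounded_by_profile]. *)
Lemma fourier_profile_le c w l M : 0 < c -> measurable_fun setT w -> (forall t, `|w t| <= 1) ->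
  0 <= l -> (\int[mu]_(t in `]0%R, +oo[) `|w t|%:E <= M%:E)%E ->
  fourier_profile c w l <= 2 / pi * c * l * M.
Proof.
move=> c0 mw w1 l0 wM.
have pi0 := @pi_gt0 R.
rewrite -lee_fin (fourier_profileE c0 mw w1).
have -> : (2 / pi * c * l * M)%:E = ((2 / pi * c)%:E * (l * M)%:E)%E by rewrite -EFinM mulrA.
apply: lee_wpmul2l; first by rewrite lee_fin mulr_ge0 ?(ltW c0)// divr_ge0// ltW.
apply: (@le_trans _ _ (\int[mu]_(t in `]0%R, +oo[) (l%:E * `|w t|%:E))%E); last first.
  rewrite ge0_integralZl//=.
  - by rewrite EFinM lee_wpmul2l// lee_fin.
  - by apply/measurable_EFinP; apply: measurable_funTS; exact: measurableT_comp.
apply: le_trans (lee_abs _) _.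
apply: le_trans (le_abse_integral _ _ _) _ => //.
  by have /measurable_int := integrable_fp_kernel c0 mw w1 l.
apply: ge0_le_integral => //=.
- apply/measurable_EFinP; apply: measurableT_comp => //; apply: measurable_funTS.
  exact: measurable_fp_kernel1.
- apply: measurable_funeM; apply/measurable_EFinP; apply: measurable_funTS.
  exact: measurableT_comp.
- move=> t _; rewrite -EFinM lee_fin /fp_kernel !normrM (ger0_norm l0).
  rewrite ler_wpM2r// -mulrA ler_piMr// mulr_ile1 ?normr_sinc_le1//.
Qed.

End profile_bounds.

(** * Independence and laws of sums *)

Section quantile.
Context {R : realType}.
Local Notation mu := (@lebesgue_measure R).

Lemma probability_unique_ray (m1 m2 : probability R R) :
  (forall x : R, m1 `]x, +oo[%classic = m2 `]x, +oo[%classic) ->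
  forall A, measurable A -> m1 A = m2 A.
Proof.
move=> m12; refine (@measure_unique _ R R (@RGenOInfty.G R) (fun n : nat => `](- n%:R : R), +oo[%classic) _ _ _ _ m1 m2 _ _).
- exact: RGenOInfty.measurableE.
- move=> _ _ [x ->] [y ->]; exists (Num.max x y).
  by apply/seteqP; split => z /=; rewrite !in_itv/= !andbT gt_max => /andP.
- by move=> n; eexists.
- rewrite -subTset => x _; exists (Num.bound `|x|) => //=.
  rewrite in_itv/= andbT ltrNl; apply: (le_lt_trans (y := `|x|)).
    by rewrite -normrN ler_norm.
  exact: archi_boundP.
- by move=> _ [x ->]; exact: m12.
- by move=> n; apply: (le_lt_trans (probability_le1 _ _)) => //; exact: ltry.
Qed.

Context d (T : measurableType d) (P : probability T R).

(* The quantile function [v |-> inf {x | v <= b F x}] of [X], where [F] is its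
   distribution function and [b = 1 / K]. *)
Lemma quantile (X : {RV P >-> R}) (K : R) : 0 < K ->
  (forall A, measurable A -> (distribution P X A <= K%:E * mu A)%E) ->
  exists q : R -> R, expanding `]0, K^-1[ q /\
    forall f : R -> \bar R, measurable_fun setT f -> (forall x, 0 <= f x)%E ->
      (\int[P]_w f (X w) = K%:E * \int[mu]_(v in `]0%R, K^-1%R[) f (q v))%E.
Proof.
move=> K0 XK.
pose F x := fine (distribution P X `]-oo, x]).
have FE x : (F x)%:E = distribution P X `]-oo, x] by rewrite fineK// fin_num_measure.
have F0 x : 0 <= F x by rewrite fine_ge0.
have F1 x : F x <= 1 by rewrite -lee_fin FE; exact: probability_le1.
have FGE x : (distribution P X `]x, +oo[%classic = 1 - (F x)%:E)%E.
  by rewrite FE -setCitvl probability_setC.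
have Fnd x y : x <= y -> F x <= F y.
  by move=> xy; rewrite -lee_fin !FE le_measure ?inE//; exact: subset_itvl.
have FK x y : x <= y -> F y - F x <= K * (y - x).
  move=> xy; rewrite -lee_fin EFinB !FE.
  have -> : (`]-oo, y] = `]-oo, x] `|` `]x, y] :> set R)%classic.
    by rewrite -itv_bndbnd_setU// ?bnd_simp.
  rewrite measureU//; last first.
    by apply/seteqP; split => z //=; rewrite !in_itv/= => -[zx /andP[/(le_lt_trans zx)]]; rewrite ltxx.
  rewrite addeAC subee ?fin_num_measure// add0e.
  apply: (le_trans (XK _ (measurable_itv _))).
  by rewrite lebesgue_measure_itv/= lte_fin; case: ltP => // yx; rewrite mule0 lee_fin mulr_ge0// ?(ltW K0) ?subr_ge0.
have Fy e : e < 1 -> exists x, e <= F x.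
  move=> e1; have := @cvg_cdfy1 _ _ _ P X => /fine_cvg/= /cvgrPdist_lt /(_ (1 - e)).
  rewrite subr_gt0 => /(_ e1) [M [_ MF]]; exists (M + 1).
  have := MF (M + 1); rewrite ltrDl ltr01 => /(_ isT).
  rewrite -/(F _) ger0_norm ?subr_ge0// ltrD2l ltrN2; exact: ltW.
have FNy e : 0 < e -> exists x, F x < e.
  move=> e0; have := @cvg_cdfNy0 _ _ _ P X => /fine_cvg/= /cvgrPdist_lt /(_ e e0) [M [_ MF]].
  exists (M - 1); have := MF (M - 1); rewrite gtrBl ltr01 => /(_ isT).
  by rewrite -/(F _) sub0r normrN ger0_norm.
pose S v := [set x | v * K <= F x].
pose q v := if (v \in `]0, K^-1[) then inf (S v) else 0.
have b0 : 0 < K^-1 by rewrite invr_gt0.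
(* The Galois correspondence between [q] and [F]. The infimum is attained because [F] is Lipschitz
   by [FK]: from a value below [v * K] at [x] it needs at least [(v * K - F x) / K] to reach
   [v * K]. *)
have qle v x : 0 < v < K^-1 -> (q v <= x) = (v * K <= F x).
  move=> /[dup] vb /andP[v0 vb']; rewrite /q in_itv/= vb.
  have vK1 : v * K < 1 by rewrite -ltr_pdivlMr// div1r.
  have [y yS] := Fy _ vK1.
  have [z zS] := FNy _ (mulr_gt0 v0 K0).
  have lbS : has_inf (S v).
    split; first by exists y.
    exists z; rewrite /S => t /= tS; rewrite leNgt; apply/negP => /ltW/Fnd; rewrite leNgt => /negP; apply.
    exact: lt_le_trans zS tS.
  apply/idP/idP => [|xS]; last by apply: ge_inf => //; case: lbS.
  apply: contraTT; rewrite -!ltNge => xS.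
  have e0 : 0 < (v * K - F x) / K by rewrite divr_gt0// subr_gt0.
  apply: (@lt_le_trans _ _ (x + (v * K - F x) / K)); first by rewrite ltrDl.
  apply: lb_le_inf; first by exists y.
  rewrite /S => t /= tS; have [tx|/ltW xt] := leP t x.
    by have := Fnd _ _ tx; rewrite leNgt (lt_le_trans xS tS).
  rewrite -lerBrDl ler_pdivrMr//; have := FK _ _ xt; lra.
(* Going back from [q w] by [w - v] lowers [F] by at most [K * (w - v)], so its value there is still
   at least [v * K]. *)
have qe : expanding `]0, K^-1[ q.
  move=> v w; rewrite /= !in_itv/= => vb wb vw.
  rewrite lerBrDr -lerBrDl opprB addrC.
  have [vb' wb'] : 0 < v < K^-1 /\ 0 < w < K^-1 by [].
  have := lexx (q w); rewrite {1}(qle _ _ wb') => wq.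
  rewrite (qle _ _ vb').
  have : v - w + q w <= q w by lra.
  move=> /FK; lra.
have mq : measurable_fun setT q.
  have -> : q = q \_ `]0, K^-1[.
    by apply/funext => v; rewrite patchE mem_setE /q; case: ifPn.
  apply/(measurable_restrictT _ _).1 => //.
  by apply: (measurable_expanding _ qe); exact: interval_is_interval.
pose U := uniform_prob b0.
pose Q : {mfun measurableTypeR R >-> R} := HB.pack_for {mfun measurableTypeR R >-> R} q (isMeasurableFun.Build _ _ (measurableTypeR R) R q mq).
have intU (g : R -> \bar R) : measurable_fun setT g -> (forall x, 0 <= g x)%E ->
    (\int[U]_v g v = K%:E * \int[mu]_(v in `]0%R, K^-1%R[) g v)%E.
  move=> mg g0; rewrite integral_uniform// subr0 invrK.
  by rewrite (@integral_itv_bndoo _ 0 K^-1 g true false)//; apply: measurable_funTS.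
have UE A : measurable A -> U A = (K%:E * mu (A `&` `]0%R, K^-1%R[))%E.
  move=> mA; transitivity (\int[U]_v (\1_A v)%:E)%E.
    by rewrite integral_indic// setIT.
  rewrite intU ?integral_indic//.
  by apply/measurable_EFinP; exact: measurable_indic.
have PU A : measurable A -> distribution P X A = distribution U Q A.
  apply: probability_unique_ray => x; apply: (etrans (FGE x)).
  have mA : measurable (q @^-1` `]x, +oo[%classic) by rewrite -[X in measurable X]setTI; exact: (mq measurableT).
  transitivity (U (q @^-1` `]x, +oo[%classic)) => //.
  rewrite UE//.
  have -> : (q @^-1` `]x, +oo[ `&` `]0, K^-1[ = `]F x / K, K^-1[ :> set R)%classic.
    apply/seteqP; split => v /=; rewrite !in_itv/= andbT.
      move=> [qx /[dup] vb /andP[_ ->]]; rewrite andbT ltr_pdivrMr// ltNge -(qle _ _ vb) -ltNge//.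
    move=> /andP[Fv vK]; have vb : 0 < v < K^-1.
      by rewrite vK andbT; apply: le_lt_trans Fv; rewrite divr_ge0// ltW.
    by split => //; rewrite ltNge (qle _ _ vb) -ltNge -ltr_pdivrMr.
  rewrite lebesgue_measure_itv/= lte_fin.
  case: ltP => [_|].
    by rewrite -!EFinB -EFinM; congr EFin; field; rewrite gt_eqF.
  rewrite -[leLHS]div1r ler_pM2r ?invr_gt0// => F1x.
  have -> : F x = 1 by apply/eqP; rewrite eq_le F1 F1x.
  by rewrite mule0 -EFinB subrr.
exists q; split => // f mf f0.
transitivity (\int[distribution P X]_y f y)%E; first by rewrite ge0_integral_distribution.
transitivity (\int[distribution U Q]_y f y)%E; first by apply: eq_measure_integral => A mA _; exact: PU.
rewrite ge0_integral_distribution//= intU//.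
by apply: measurableT_comp.
Qed.
End quantile.

(** * Independence of one variable and a sum of others *)

Section joint_law.
Context d (T : measurableType d) (R : realType) (P : probability T R).

(** Finite measures on the plane that agree on measurable rectangles coincide. The event [E] carries
    the conditions on further variables through the induction of [mutually_independent_sum]. *)
Lemma joint_law (Y Z : {RV P >-> R}) (E : set T) : measurable E ->
  (forall A B : set R, measurable A -> measurable B ->
    P (Y @^-1` A `&` Z @^-1` B `&` E) = (P E * (P (Y @^-1` A) * P (Z @^-1` B)))%E) ->
  forall C : set (R * R), measurable C ->
    P ((fun w => (Y w, Z w)) @^-1` C `&` E) =
    (P E * (distribution P Y \x distribution P Z) C)%E.
Proof.
move=> mE YZE C mC.
have mYZ : measurable_fun setT (fun w => (Y w, Z w)) by exact: measurable_fun_pair.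
pose m1 : {measure set (R * R) -> \bar R} := measure_function_pushforward__canonical__measure_function_Measure (mrestr P mE) mYZ.
have p0 : 0 <= fine (P E) by rewrite fine_ge0.
pose m2 : {measure set (R * R) -> \bar R} := mscale (NngNum p0) (distribution P Y \x distribution P Z)%E.
have m2E A : m2 A = (P E * (distribution P Y \x distribution P Z) A)%E.
  by rewrite /m2/= /mscale/= fineK// fin_num_measure.
rewrite -m2E; transitivity (m1 C) => //.
apply: (@measure_unique _ R (R * R)%type
  [set C | exists A, measurable A /\ exists B, measurable B /\ C = A `*` B] (fun=> setT) _ _ _ _ m1 m2 _ _) => //.
- rewrite measurable_prod_measurableType //; congr (<<s _ >>).
  rewrite predeqE; split => [[A mA [B mB <-]]|[A [mA [B [mB ->]]]]].
    by exists A; split => //; exists B.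
  by exists A => //; exists B.
- move=> _ _ [A [mA [B [mB ->]]]] [A' [mA' [B' [mB' ->]]]].
  exists (A `&` A'); split; first exact: measurableI.
  by exists (B `&` B'); split; [exact: measurableI|rewrite setXI].
- by move=> _; exists setT; split => //; exists setT; split => //; rewrite setXTT.
- by rewrite bigcup_const//; exists 0%N.
- move=> _ [A [mA [B [mB ->]]]]; rewrite m2E product_measure1E//.
  exact: YZE.
- move=> _; rewrite /m1/= /pushforward /mrestr preimage_setT setTI.
  by apply: (le_lt_trans (probability_le1 _ _)) => //; exact: ltry.
Qed.

Lemma bigcap_preimage_setU1 (I : finType) (U : Type) (Y : I -> T -> U) (J : {set I}) (i : I)
    (A : I -> set U) (B : set U) : i \notin J ->
  Y i @^-1` B `&` \bigcap_(j in [set` J]) (Y j @^-1` A j) =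
  \bigcap_(j in [set` (i |: J)%SET]) (Y j @^-1` (if j == i then B else A j)).
Proof.
move=> iJ; have A'J j : j \in J -> (j == i) = false.
  by move=> jJ; apply: contraNF iJ => /eqP <-.
apply/seteqP; split => [w [/= wB wA] j /=|w wA].
  by rewrite in_setU1 => /orP[/eqP->|jJ]; [rewrite eqxx|rewrite A'J//; exact: wA].
split; first by have := wA i; rewrite /= in_setU1 eqxx; exact.
by move=> j /= jJ; have := wA j; rewrite /= in_setU1 jJ orbT A'J//; exact.
Qed.

Lemma mutually_independent_capI (I : finType) (Y : I -> {RV P >-> R}) (J : {set I}) (i : I)
    (A : I -> set R) (B : set R) : mutually_independent P Y -> i \notin J ->
  (forall j, measurable (A j)) -> measurable B ->
  P (Y i @^-1` B `&` \bigcap_(j in [set` J]) (Y j @^-1` A j)) =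
  (P (Y i @^-1` B) * P (\bigcap_(j in [set` J]) (Y j @^-1` A j)))%E.
Proof.
move=> indY iJ mA mB; rewrite bigcap_preimage_setU1// !indY//; last by move=> j; case: ifP.
rewrite big_setU1//= eqxx; congr (_ * _)%E; apply: eq_bigr => j jJ.
by case: eqP => // ji; rewrite -ji jJ in iJ.
Qed.

(** By induction on [s], for all index sets [J] at once: when [Y i] is split off, the condition on
    it joins the event. The induction hypothesis then shows that [Y i] and the remaining sum have a
    product law on the event, and [joint_law] applies to the sum of the two. *)
Lemma mutually_independent_sum (I : finType) (Y : I -> {RV P >-> R}) (s : seq I) (J : {set I})
    (A : I -> set R) (B : set R) : mutually_independent P Y -> uniq s ->
  (forall i, i \in s -> i \notin J) -> (forall i, measurable (A i)) -> measurable B ->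
  P ((\sum_(i <- s) Y i) @^-1` B `&` \bigcap_(i in [set` J]) (Y i @^-1` A i)) =
  (P ((\sum_(i <- s) Y i)%R @^-1` B) * P (\bigcap_(i in [set` J]) (Y i @^-1` A i)))%E.
Proof.
move=> indY; elim: s J A B => [|i s IH] J A B us sJ mA mB.
  rewrite big_nil.
  have [B0|B0] := pselect (B 0).
    have -> : (0 : {RV P >-> R}) @^-1` B = setT by apply/seteqP; split.
    by rewrite setTI probability_setT mul1e.
  have -> : (0 : {RV P >-> R}) @^-1` B = set0 by apply/seteqP; split.
  by rewrite set0I measure0 mul0e.
move: us => /= /andP[nis us].
have mcap (K : {set I}) (A' : I -> set R) : (forall i, measurable (A' i)) ->
    measurable (\bigcap_(i in [set` K]) (Y i @^-1` A' i)).
  move=> mA'; apply: fin_bigcap_measurable; first exact: finite_finset.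
  by move=> j _; exact: measurable_funPTI.
rewrite big_cons; set Z := \sum_(j <- s) Y j.
pose C : set (R * R) := (fun z => z.1 + z.2) @^-1` B.
have mC : measurable C.
  by rewrite -[X in measurable X]setTI; apply: measurable_funD.
have ZE (K : {set I}) (A' : I -> set R) : (forall i, measurable (A' i)) ->
    (forall j, j \in i :: s -> j \notin K) ->
    P ((Y i + Z) @^-1` B `&` \bigcap_(i in [set` K]) (Y i @^-1` A' i)) =
    (P (\bigcap_(i in [set` K]) (Y i @^-1` A' i)) * (distribution P (Y i) \x distribution P Z) C)%E.
  move=> mA' sK; rewrite -joint_law//; first exact: mcap.
  move=> D D' mD mD'.
  have iK : i \notin K by apply: sK; rewrite mem_head.
  rewrite setIAC setIC bigcap_preimage_setU1// IH//.
  - by rewrite -bigcap_preimage_setU1// mutually_independent_capI// muleC -muleA muleCA.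
  - move=> j js; rewrite in_setU1 negb_or sK ?andbT; last by rewrite inE js orbT.
    by apply: contraNN nis => /eqP <-.
  - by move=> j; case: ifP.
rewrite ZE// muleC; congr (_ * _)%E.
(* For the empty index set the event is the whole space; this identifies the product measure of [C]
   with the probability that the sum lies in [B]. *)
have := ZE finset.set0 (fun=> setT) (fun=> measurableT) (fun j _ => negbT (finset.in_set0 j)).
have -> : \bigcap_(j in [set` (finset.set0 : {set I})]) (Y j @^-1` setT) = setT.
  by apply/seteqP; split => // w _ j /=; rewrite finset.in_set0.
by rewrite setIT probability_setT mul1e.
Qed.

Lemma mutually_independent_sum2 (I : finType) (Y : I -> {RV P >-> R}) (i : I) (s : seq I)
    (A B : set R) : mutually_independent P Y -> uniq (i :: s) -> measurable A -> measurable B ->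
  P (Y i @^-1` A `&` (\sum_(j <- s) Y j) @^-1` B) =
  (P (Y i @^-1` A) * P ((\sum_(j <- s) Y j)%R @^-1` B))%E.
Proof.
move=> indY /= /andP[nis us] mA mB; rewrite setIC.
have := @mutually_independent_sum _ Y s [set i]%SET (fun=> A) B indY us.
have -> : \bigcap_(j in [set` [set i]%SET]) (Y j @^-1` A) = Y i @^-1` A.
  apply/seteqP; split => [w /(_ i)|w wD j /=]; last by rewrite inE => /eqP->.
  by rewrite /= inE eqxx; exact.
rewrite muleC; apply => // j js; rewrite inE.
by apply: contraNN nis => /eqP <-.
Qed.

Lemma distribution_add (Y Z : {RV P >-> R}) (A : set R) :
  (forall D D', measurable D -> measurable D' ->
    P (Y @^-1` D `&` Z @^-1` D') = (P (Y @^-1` D) * P (Z @^-1` D'))%E) ->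
  measurable A ->
  distribution P (Y + Z) A = (\int[P]_w distribution P Z [set z | A (Y w + z)%R])%E.
Proof.
move=> YZ mA.
pose C : set (R * R) := (fun z => z.1 + z.2) @^-1` A.
have mC : measurable C by rewrite -[X in measurable X]setTI; apply: measurable_funD.
have <- : (distribution P Y \x distribution P Z)%E C = distribution P (Y + Z) A.
  rewrite -[LHS]mul1e -(probability_setT P) -joint_law// ?setIT// => D D' mD mD'.
  by rewrite setIT probability_setT mul1e YZ.
rewrite /product_measure1 ge0_integral_distribution//.
- by apply: eq_integral => w _ /=; congr (distribution P Z _); apply/seteqP; split => z; rewrite /xsection/= inE.
- exact: measurable_fun_xsection.
Qed.

Lemma measurable_distribution_shift (Z : {RV P >-> R}) (A : set R) : measurable A ->
  measurable_fun setT (fun x : R => distribution P Z [set z | A (x + z)]).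
Proof.
move=> mA; pose C : set (R * R) := (fun z => z.1 + z.2) @^-1` A.
have mC : measurable C by rewrite -[X in measurable X]setTI; apply: measurable_funD.
rewrite (_ : (fun _ => _) = (distribution P Z) \o xsection C); first exact: measurable_fun_xsection.
by apply/funext => x /=; congr (distribution P Z _); apply/seteqP; split => z; rewrite /xsection/= inE.
Qed.
End joint_law.

(** * Profiles of sums of independent variables *)

Section independent_profile.
Context d (T : measurableType d) (R : realType) (P : probability T R).
Local Notation mu := (@lebesgue_measure R).

Lemma measurable_preimage_affine (a x : R) (A : set R) : measurable A ->
  measurable ((fun t => a * t + x) @^-1` A).
Proof. by move=> mA; have := measurable_affine a x measurableT mA; rewrite setTI. Qed.

Lemma preimage_shift (x : R) (A : set R) :
  [set z | A (x + z)] = (fun t => 1 * t + x) @^-1` A.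
Proof. by apply/seteqP; split => z /=; rewrite mul1r addrC. Qed.

Lemma measurable_shift (x : R) (A : set R) : measurable A -> measurable [set z | A (x + z)].
Proof. by move=> mA; rewrite preimage_shift; exact: measurable_preimage_affine. Qed.

Lemma lebesgue_measure_shift (x : R) (A : set R) : measurable A ->
  mu [set z | A (x + z)] = mu A.
Proof.
by move=> mA; rewrite preimage_shift lebesgue_measure_affine ?oner_eq0// normr1 invr1 mul1e.
Qed.

(** The density bound expressed on the law, without choosing a version of the density. For positive
    bounds [density_bounded_law] and [law_bounded_density] show that the two notions agree. *)
Definition law_bounded_by (X : {RV P >-> R}) (M : R) :=
  forall A, measurable A -> (distribution P X A <= M%:E * mu A)%E.

Lemma law_bounded_byZ (X : {RV P >-> R}) (M a : R) : a != 0 ->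
  law_bounded_by X M -> law_bounded_by (a *: X) (M / `|a|).
Proof.
move=> a0 XM A mA.
have mA' := measurable_preimage_affine a 0 mA.
have -> : distribution P (a *: X) A = distribution P X ((fun x => a * x + 0) @^-1` A).
  rewrite /distribution /pushforward; congr (P _); apply/seteqP; split => w /=; rewrite addr0//.
apply: (le_trans (XM _ mA')).
by rewrite lebesgue_measure_affine// EFinM muleA.
Qed.

Definition shifted_law (Z : {RV P >-> R}) (A : set R) (x : R) : R :=
  fine (distribution P Z [set z | A (x + z)]).

Lemma shifted_lawE (Z : {RV P >-> R}) (A : set R) (x : R) : measurable A ->
  (shifted_law Z A x)%:E = distribution P Z [set z | A (x + z)].
Proof.
by move=> mA; rewrite fineK// fin_num_measure//; exact: measurable_shift.
Qed.

Lemma measurable_shifted_law (Z : {RV P >-> R}) (A : set R) : measurable A ->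
  measurable_fun setT (shifted_law Z A).
Proof.
move=> mA; apply/measurable_EFinP.
rewrite (_ : _ \o _ = (fun x : R => distribution P Z [set z | A (x + z)])).
  exact: measurable_distribution_shift.
by apply/funext => x; exact: shifted_lawE.
Qed.

Lemma shifted_law_cons (I : finType) (Y : I -> {RV P >-> R}) (i : I) (s : seq I) (A : set R) (x : R) :
  mutually_independent P Y -> uniq (i :: s) -> measurable A ->
  (shifted_law (\sum_(j <- i :: s) Y j) A x)%:E =
  (\int[P]_w (shifted_law (\sum_(j <- s) Y j)%R A (x + Y i w)%R)%:E)%E.
Proof.
move=> indY us mA; rewrite shifted_lawE// big_cons distribution_add//.
- apply: eq_integral => w _; rewrite shifted_lawE//; congr (distribution P _ _).
  by apply/seteqP; split => z /=; rewrite addrA.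
- by move=> D D' mD mD'; exact: mutually_independent_sum2.
- exact: measurable_shift.
Qed.

Lemma profile_sum (I : finType) (Y : I -> {RV P >-> R}) (b : I -> R) (s : seq I) (y c : R) :
  mutually_independent P Y -> (forall i, 0 <= b i) ->
  (forall i, b i = 0 -> forall w, Y i w = 0) ->
  (forall i, 0 < b i -> law_bounded_by (Y i) (b i)^-1) ->
  0 < c -> uniq s ->
  profile (shifted_law (\sum_(i <- s) Y i) `[y, y + c])
          (fourier_profile c (fun t => \prod_(i <- s) sinc (b i * t))).
Proof.
move=> indY b_ge0 b0Y bY c0; elim: s => [_|i s IH /[dup] us /= /andP[_ us']].
  have -> : shifted_law (\sum_(i <- [::]) Y i) `[y, y + c] = window y c.
    apply/funext => x; rewrite big_nil /shifted_law /distribution /pushforward /window indicE.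
    have [xy|xy] := boolP (x \in (`[y, y + c]%classic : set R)).
      rewrite (_ : _ @^-1` _ = setT) ?probability_setT//.
      by apply/seteqP; split => // w _ /=; rewrite addr0; exact: set_mem.
    rewrite (_ : _ @^-1` _ = set0) ?measure0//.
    by apply/seteqP; split => // w /=; rewrite addr0 => h; case/negP: xy; exact: mem_set.
  under [X in fourier_profile _ X]eq_fun do rewrite big_nil.
  apply: (le_profile _ (profile_window y (ltW c0))) => l l0.
  exact: fourier_profile1.
have mI : measurable (`[y, y + c]%classic : set R) by exact: measurable_itv.
(* A zero length leaves no interval to average over; the variable vanishes and its factor is
   [sinc 0 = 1]. *)
have [bi0|bi0] := eqVneq (b i) 0.
  under [X in fourier_profile _ X]eq_fun do rewrite big_cons bi0 mul0r sinc0 mul1r.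
  rewrite (_ : shifted_law _ _ = shifted_law (\sum_(j <- s) Y j) `[y, y + c]); first exact: IH.
  apply/funext => x; apply: EFin_inj; rewrite shifted_law_cons//.
  under eq_integral do rewrite b0Y// addr0.
  rewrite (integral_cst P measurableT).
by rewrite -[RHS]mule1; congr (_ * _)%E; exact: probability_setT.
have {bi0} bi0 : 0 < b i by rewrite lt_neqAle eq_sym bi0 b_ge0.
(* [profile_step] translates by [- q v], as hooks need a difference [e - q]. Hence the quantile
   function of the opposite variable is taken. *)
have Yb : law_bounded_by (- 1 *: Y i) (b i)^-1.
  have N10 : -1 != 0 :> R by rewrite oppr_eq0 oner_eq0.
  by have := law_bounded_byZ N10 (bY i bi0); rewrite normrN1 divr1.
have bi'0 : 0 < (b i)^-1 by rewrite invr_gt0.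
have [q [qe qY]] := quantile bi'0 Yb.
rewrite invrK in qe qY.
apply: (profile_step bi0 (measurable_shifted_law _ mI) _ qe _ (IH us')).
- by move=> x; rewrite fine_ge0.
- move=> x; rewrite shifted_law_cons//.
  rewrite -(qY (fun z => (shifted_law (\sum_(j <- s) Y j)%R `[y, y + c] (x - z)%R)%:E)).
  + apply: eq_integral => w _ /=.
    congr ((shifted_law _ _ (x + _))%:E).
    by rewrite -[LHS]opprK; congr (- _); exact/esym/mulN1r.
  + apply/measurable_EFinP; apply: (measurableT_comp (measurable_shifted_law _ mI)).
    exact: measurable_funB.
  + by move=> z; rewrite lee_fin fine_ge0.
move=> m m0.
have [mQ ->] := fourier_profile_step c0 (measurable_prod_sinc s b) (normr_prod_sinc_le1 s b) bi0 m0.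
split => //.
rewrite (_ : (fun t => \prod_(j <- i :: s) sinc (b j * t)) =
  (fun t => (\prod_(j <- s) sinc (b j * t)) * sinc (b i * t)))//.
by apply/funext => t; rewrite big_cons mulrC.
Qed.
End independent_profile.

Arguments law_bounded_by {d T R} P X M.

(** * Density bounds as bounds on laws *)

Section law_bounded.
Context d (T : measurableType d) (R : realType) (P : probability T R).
Local Notation mu := (@lebesgue_measure R).
Implicit Types (X : {RV P >-> R}) (M y z c l : R).

(** Lebesgue measure is the infimum of the total lengths of countable covers by half-open intervals,
    and the law is countably subadditive. *)
Lemma law_bounded_by_itv X M : 0 < M ->
  (forall y z, y <= z -> (distribution P X `]y, z] <= (M * (z - y))%:E)%E) ->
  law_bounded_by P X M.
Proof.
move=> M0 XM A mA.
rewrite -lee_pdivrMl//.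
rewrite /lebesgue_measure /lebesgue_stieltjes_measure /measure_extension /mu_ext.
apply: le_ereal_inf_tmp => _ [F [mF AF] <-].
rewrite lee_pdivrMl//.
have mF' k : measurable (F k : set R) by apply: sub_sigma_algebra; exact: mF.
apply: (@le_trans _ _ (\sum_(k <oo) distribution P X (F k))%E).
  exact: measure_sigma_subadditive.
rewrite -nneseriesZl//.
apply: lee_nneseries => // k _.
have [[a b] _ <- /=] := mF k.
have [ab|ba] := leP a b.
  by rewrite wlength_itv_bnd// -EFinM XM.
by rewrite set_itv_ge ?measure0 ?wlength0 ?mule0// bnd_simp -leNgt ltW.
Qed.

(** Translations by [x] in []0, l[] send []y, z]] into a window of length [c = z - y + l], so [p] is
    below the shifted law along the identity, which is expanding. Integration gives
    [p * l <= M * c * l], and [l] is chosen to make the excess equal to [e]. *)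
Lemma law_bounded_by_profile X M : 0 < M ->
  (forall y c, 0 < c -> profile (shifted_law X `[y, y + c]) (fun l => M * c * l)) ->
  law_bounded_by P X M.
Proof.
move=> M0 XM; apply: law_bounded_by_itv => // y z yz.
rewrite -[leLHS]fineK ?fin_num_measure// lee_fin.
set p := fine _.
apply/ler_addgt0Pr => e e0.
pose l := e / M; have l0 : 0 < l by rewrite divr_gt0.
pose c := z - y + l; have c0 : 0 < c by rewrite ltr_wpDl// subr_ge0.
have -> : M * (z - y) + e = M * c by rewrite /c /l; field; rewrite gt_eqF.
rewrite -(ler_pM2r l0) -lee_fin.
have idexp : expanding `]0, l[ idfun by move=> u v *; rewrite lexx.
apply: le_trans (XM y c c0 l idfun (ltW l0) idexp).
apply: (@le_trans _ _ (\int[mu]_(x in `]0%R, l[) p%:E)%E).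
  rewrite integral_cst//= lebesgue_measure_itv/= lte_fin l0.
  by rewrite -EFinB subr0 EFinM.
apply: ge0_le_integral => //=.
- by move=> x _; rewrite lee_fin fine_ge0.
- apply/measurable_EFinP; apply: measurable_funTS.
  by apply: measurable_shifted_law; exact: measurable_itv.
move=> x; rewrite in_itv/= => /andP[x0 xl].
rewrite shifted_lawE//.
rewrite fineK ?fin_num_measure//.
rewrite le_measure ?inE//; last first.
  by move=> w /=; rewrite !in_itv/= /c => /andP[yw wz]; apply/andP; split; lra.
by apply: measurable_shift; exact: measurable_itv.
Qed.

Lemma density_bounded_gt0 X K : density_bounded_by P X K -> 0 < K.
Proof.
move=> [[f [mf f0 fX]] fK]; have {}fK := fK f (And3 mf f0 fX).
rewrite ltNge; apply/negP => K0.
have := fX _ measurableT; rewrite probability_setT.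
rewrite (@ae_eq_integral _ _ _ mu setT (cst 0%E)) ?integral0//.
- by move=> /eqP; rewrite onee_eq0.
- exact/measurable_EFinP.
- move: fK; apply: negligibleS => x /=; apply: contra_not => fx _.
  by congr EFin; apply/eqP; rewrite eq_le f0 (le_trans fx).
Qed.

Lemma density_bounded_law X K : density_bounded_by P X K -> law_bounded_by P X K.
Proof.
move=> XK A mA; have K0 := density_bounded_gt0 XK.
move: XK => [[f [mf f0 fX]] fK]; have {}fK := fK f (And3 mf f0 fX).
rewrite fX// -[leRHS](integral_cst mu mA).
apply: ae_ge0_le_integral => //=.
- by move=> x _; rewrite lee_fin.
- by apply/measurable_EFinP; exact: measurable_funTS.
- by move=> x _; rewrite lee_fin ltW.
- move: fK; apply: negligibleS => x /=; apply: contra_not => fx _.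
  by rewrite lee_fin.
Qed.

Lemma law_bounded_density X M : 0 < M -> law_bounded_by P X M -> density_bounded_by P X M.
Proof.
move=> M0 XM; split.
  (* Radon-Nikodym requires both measures to live on [measurableTypeR R], whose measurable structure
     has the same sets as that of [R] but another display. *)
  have mX : measurable_fun setT (X : T -> measurableTypeR R) by exact: (@measurable_funPT _ _ _ _ X).
  pose X' : {mfun T >-> measurableTypeR R} := HB.pack_for {mfun T >-> measurableTypeR R} (X : T -> measurableTypeR R)
    (isMeasurableFun.Build _ _ T (measurableTypeR R) X mX).
  have dom : distribution P X' `<< mu.
    apply/null_content_dominatesP => A mA muA0.
    by apply/eqP; rewrite eq_le measure_ge0 andbT -(mule0 M%:E) -muA0; exact: XM.
  pose f := Radon_Nikodym_SigmaFinite.f (distribution P X') mu.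
  have ffin x : f x \is a fin_num by exact: Radon_Nikodym_SigmaFinite.f_fin_num.
  exists (fine \o f); split.
  - apply: measurableT_comp => //.
    exact: (measurable_int _ (Radon_Nikodym_SigmaFinite.f_integrable dom)).
  - by move=> x; rewrite fine_ge0// Radon_Nikodym_SigmaFinite.f_ge0.
  - move=> A mA; transitivity (distribution P X' A) => //.
    rewrite (Radon_Nikodym_SigmaFinite.f_integral dom mA).
    by apply: eq_integral => x _ /=; rewrite fineK.
move=> f [mf f0 fX].
(* A version exceeds [M] only on the union of the [A n]. Each has finite measure, as its probability
   is finite, and its probability is at most [M] and at least [M + n.+1%:R^-1] times its measure,
   which is therefore zero. *)
pose A (n : nat) := [set x | M + n.+1%:R^-1 <= f x].
have mA n : measurable (A n).
  have -> : A n = f @^-1` `[M + n.+1%:R^-1, +oo[.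
    by apply/seteqP; split => x; rewrite /A/= in_itv/= andbT.
  by rewrite -[X in measurable X]setTI; exact: mf.
have A0 n : mu (A n) = 0%E.
  have e0 : 0 < n.+1%:R^-1 :> R by rewrite invr_gt0.
  have le1 : ((M + n.+1%:R^-1)%:E * mu (A n) <= distribution P X (A n))%E.
    rewrite fX// -(integral_cst mu (mA n)); apply: ge0_le_integral => //=.
    - exact: mA.
    - by move=> x _; rewrite lee_fin addr_ge0// ltW.
    - by apply/measurable_EFinP; exact: measurable_funTS.
  have fin : mu (A n) \is a fin_num.
    rewrite ge0_fin_numE//; move: le1; case: (mu (A n)) (measure_ge0 mu (A n)) => [r| |]//= _.
      by rewrite ltry.
    rewrite gt0_muley ?lte_fin ?addr_gt0// leye_eq => /eqP h.
    by have : distribution P X (A n) \is a fin_num by [exact: fin_num_measure]; rewrite h.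
  move: (le_trans le1 (XM _ (mA n))); rewrite -(fineK fin) -!EFinM lee_fin => h.
  congr EFin; apply/eqP; rewrite eq_le fine_ge0// andbT.
  by rewrite -(pmulr_rle0 _ e0); move: h; rewrite mulrDl gerDl.
have : mu.-negligible (\bigcup_n A n).
  by apply: negligible_bigcup => n; exists (A n); split; [exact: mA|exact: A0|].
apply: negligibleS => x /= /negP; rewrite -ltNge => /ltr_add_invr[n nf].
by exists n => //; exact: ltW.
Qed.
End law_bounded.

(** * The density bound for the weighted sum *)

Section density_of_sum.
Context d (T : measurableType d) (R : realType) (P : probability T R).
Local Notation mu := (@lebesgue_measure R).

Lemma mutually_independentZ (I : finType) (X : I -> {RV P >-> R}) (a : I -> R) :
  mutually_independent P X -> mutually_independent P (fun i => a i *: X i).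
Proof.
move=> indX J A mA.
have mA' i := measurable_preimage_affine (a i) 0 (mA i).
have pE i : (a i *: X i) @^-1` A i = X i @^-1` ((fun x => a i * x + 0) @^-1` A i).
  by apply/seteqP; split => w /=; rewrite addr0.
under eq_bigr do rewrite pE.
rewrite -(indX J _ mA'); congr (P _).
by apply: eq_bigcapr => i _; exact: pE.
Qed.

Lemma law_bounded_by_add (Y Z : {RV P >-> R}) (M : R) :
  (forall D D', measurable D -> measurable D' ->
    P (Y @^-1` D `&` Z @^-1` D') = (P (Y @^-1` D) * P (Z @^-1` D'))%E) ->
  law_bounded_by P Y M -> law_bounded_by P (Y + Z) M.
Proof.
move=> YZ YM A mA; rewrite addrC distribution_add//; last first.
  by move=> D D' mD mD'; rewrite setIC YZ// muleC.
apply: (@le_trans _ _ (\int[P]_w (M%:E * mu A))%E).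
  apply: ge0_le_integral => //=.
  - by apply: (measurableT_comp (measurable_distribution_shift Y mA)); exact: measurable_funPT.
  - by move=> w _; rewrite -(lebesgue_measure_shift (Z w) mA); apply: YM; exact: measurable_shift.
rewrite (integral_cst P measurableT).
apply: (@le_trans _ _ (M%:E * mu A * 1)%E); last by rewrite mule1.
apply: lee_wpmul2l; last exact: probability_le1.
exact: le_trans (measure_ge0 _ _) (YM _ mA).
Qed.

Lemma sum_law_bounded (I : finType) (X : I -> {RV P >-> R}) (a : I -> R) (K : R) :
  0 < K -> mutually_independent P X -> (forall i, law_bounded_by P (X i) K) ->
  \sum_i a i ^+ 2 = 1 ->
  law_bounded_by P (\sum_i a i *: X i) (Num.sqrt 2 * K).
Proof.
move=> K0 indX XK a1.
pose Y i := a i *: X i.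
have indY : mutually_independent P Y by exact: mutually_independentZ.
have YK i : a i != 0 -> law_bounded_by P (Y i) (K / `|a i|) by move=> ai0; exact: law_bounded_byZ.
have s2 : 0 < Num.sqrt 2 :> R by rewrite sqrtr_gt0.
have [a2|] := pselect (forall i, a i ^+ 2 <= 1 / 2); last first.
  move=> /existsNP[j /negP]; rewrite -ltNge => aj.
  have aj0 : a j != 0 by apply: contraTN aj => /eqP ->; rewrite expr0n/= -leNgt divr_ge0.
  have us : uniq (j :: [seq i <- index_enum I | i != j]).
    by rewrite /= mem_filter eqxx/= filter_uniq// index_enum_uniq.
  rewrite (bigD1 j)//= -big_filter.
  have YZ D D' mD mD' := @mutually_independent_sum2 _ _ _ P _ Y j _ D D' indY us mD mD'.
  have := law_bounded_by_add YZ (YK j aj0).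
  move=> jS A mA; apply: (le_trans (jS A mA)); rewrite lee_wpmul2r// lee_fin.
  rewrite ler_pdivrMr ?normr_gt0// mulrAC ler_peMl ?(ltW K0)//.
  rewrite -[`|a j|]sqrtr_sqr -sqrtrM// -[leLHS]sqrtr1 ler_sqrt; last by rewrite mulr_ge0 ?sqr_ge0.
  by clear - aj; lra.
apply: law_bounded_by_profile => [|y c c0]; first by rewrite mulr_gt0.
pose b i := `|a i| / K.
have b0 i : 0 <= b i by rewrite divr_ge0// ltW.
have bY0 i : b i = 0 -> forall w, Y i w = 0.
  move=> /eqP; rewrite mulf_eq0 normr_eq0 invr_eq0 (gt_eqF K0) orbF => /eqP ai0 w.
  by rewrite /Y ai0 scale0r.
have bY i : 0 < b i -> law_bounded_by P (Y i) (b i)^-1.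
  move=> bi0; rewrite /b invf_div; apply: YK; apply: contraTN bi0 => /eqP ai0.
  by rewrite /b ai0 normr0 mul0r ltxx.
have := profile_sum y indY b0 bY0 bY c0 (index_enum_uniq I).
apply: le_profile => l l0.
set w := fun t => _.
have mw : measurable_fun setT w by exact: measurable_prod_sinc.
have sinc_abs (u t : R) : sinc (`|u| * t) = sinc (u * t).
  by have [u0|u0] := ger0P u; rewrite // mulNr sincN.
have wE t : w t = \prod_i sinc (a i * (K^-1 * t)).
  by apply: eq_bigr => i _; rewrite /b -mulrA sinc_abs.
have w1 t : `|w t| <= 1.
  exact: normr_prod_sinc_le1.
have wb : (\int[mu]_(t in `]0%R, +oo[) `|w t|%:E <= (K * (pi / 2 * Num.sqrt 2))%:E)%E.
  (* The substitution [t = K * u] removes the division by [K] in [b i] and produces the factor [K];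
     the signs of the [a i] are immaterial as [sinc] is even. *)
  rewrite (@ge0_integral_affine _ K 0 _ (fun t => `|w t|%:E))//.
  - rewrite gtr0_norm// EFinM lee_wpmul2l ?lee_fin ?(ltW K0)//.
    rewrite (_ : _ @^-1` _ = `]0, +oo[%classic); last first.
      by apply/seteqP; split => t /=; rewrite !in_itv/= !andbT addr0 pmulr_rgt0.
    apply: le_trans (ball_product a1 a2); rewrite le_eqVlt; apply/orP; left; apply/eqP.
    by apply: eq_integral => t _; rewrite wE addr0 mulKf// gt_eqF.
  - by rewrite gt_eqF.
  - by apply/measurable_EFinP; apply: measurable_funTS; exact: measurableT_comp.
have pi0 := @pi_gt0 R.
apply: (le_trans (fourier_profile_le c0 mw w1 l0 wb)).
have simp (p k s : R) : 0 < p -> 2 / p * c * l * (k * (p / 2 * s)) = s * k * c * l.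
  by move=> p0; field; rewrite gt_eqF.
by rewrite simp.
Qed.

Lemma density_bounded_sum (I : finType) (X : I -> {RV P >-> R}) (a : I -> R) (K : R) :
  mutually_independent P X -> (forall i, density_bounded_by P (X i) K) ->
  \sum_i a i ^+ 2 = 1 ->
  density_bounded_by P (\sum_i a i *: X i) (Num.sqrt 2 * K).
Proof.
move=> indX XK a1.
have K0 : 0 < K.
  (* An index exists because the squares sum to 1, and any density bound is positive. *)
  have [i _|I0] := pickP (pred_of_argType I); first exact: density_bounded_gt0 (XK i).
  by move/eqP: a1; rewrite big1 ?(eq_sym 0) ?oner_eq0// => i _; have := I0 i.
apply: law_bounded_density; first by rewrite mulr_gt0// sqrtr_gt0.
by apply: sum_law_bounded => // i; exact: density_bounded_law.
Qed.
End density_of_sum.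

(** * The extremal case *)

Section uniform_pair.
Context (R : realType) (a b : R).
Hypothesis ab : a < b.
Let U : probability (measurableTypeR R) R := uniform_prob ab.
Let T := (measurableTypeR R * measurableTypeR R)%type.
Let PU : set T -> \bar R := (U \x U)%E.

HB.instance Definition _ := Measure.on PU.

Let U1 : U setT = 1%E. Proof. exact: probability_setT. Qed.

Let PUE (A B : set (measurableTypeR R)) : measurable A -> measurable B ->
  PU (A `*` B) = (U A * U B)%E.
Proof. exact: product_measure1E. Qed.

Let PU_setT : PU setT = 1%:E.
Proof. by rewrite -setXTT PUE// U1 mule1. Qed.

HB.instance Definition _ := Measure_isProbability.Build _ _ _ PU PU_setT.

(** The coordinate projections on the plane with the product of two uniform laws. *)
Lemma uniform_pair_exists : exists (d : measure_display) (T : measurableType d)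
    (P : probability T R) (X : 'I_2 -> {RV P >-> R}),
  mutually_independent P X /\ forall j, uniformly_distributed P (X j) a b.
Proof.
pose f (j : 'I_2) : T -> R := if j == ord0 then fst else snd.
have mf j : measurable_fun setT (f j).
  by rewrite /f; case: ifP => _; [exact: measurable_fst|exact: measurable_snd].
pose X j : {mfun T >-> R} := HB.pack_for {mfun T >-> R} (f j)
  (isMeasurableFun.Build _ _ T R (f j) (mf j)).
exists _, T, PU, X.
have XE j (A : set R) : measurable A -> PU (X j @^-1` A) = U A.
  move=> mA; have [->|j1] := eqVneq j ord0.
    rewrite (_ : _ @^-1` _ = A `*` setT); first by rewrite PUE// U1 mule1.
    by apply/seteqP; split => -[x y] //= [].
  rewrite (_ : _ @^-1` _ = setT `*` A); first by rewrite PUE// U1 mul1e.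
  by apply/seteqP; split => -[x y]; rewrite /= /f (negbTE j1)// => -[].
split; last first.
  by move=> j; exists ab => A mA; exact: XE.
move=> J A mA.
(* Indices outside [J] receive the full space, of mass one, so every [J] reduces to a rectangle. *)
pose B j := if j \in J then A j else setT.
have mB j : measurable (B j) by rewrite /B; case: ifP.
have -> : \bigcap_(j in [set` J]) X j @^-1` A j = B ord0 `*` B ord_max.
  have BE j z : (X j @^-1` B j) z <-> (j \in J -> (X j @^-1` A j) z).
    by rewrite /B; case: ifP => jJ /=; split => // h; exact: h.
  apply/seteqP; split => z; first by move=> zA; split; apply/BE; exact: zA.
  move=> [z0 z1] j; have [->|j0] := eqVneq j ord0; first exact: (BE _ z).1.
  have -> : j = ord_max by apply: val_inj; case: j j0 => -[|[|]].
  by apply: (BE _ z).1; rewrite /= /f.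
apply: (etrans (PUE (mB ord0) (mB ord_max))).
have UB j : U (B j) = if j \in J then PU (X j @^-1` A j) else 1%E.
  by rewrite /B; case: ifP => _; [rewrite XE|rewrite U1].
rewrite big_mkcond big_ord_recl big_ord1 !UB.
by rewrite (_ : lift ord0 ord0 = ord_max)//; exact: val_inj.
Qed.
End uniform_pair.

(** * The triangular density and its peak *)

Section triangular_density.
Context d (T : measurableType d) (R : realType) (P : probability T R).
Local Notation mu := (@lebesgue_measure R).

Lemma is_densityZ (X : {RV P >-> R}) (f : R -> R) (a : R) : a != 0 ->
  is_density P X f -> is_density P (a *: X) (fun x => `|a|^-1 * f (a^-1 * x)).
Proof.
move=> a0 [mf f0 fX]; have a0' : a^-1 != 0 by rewrite invr_eq0.
split.
- apply: measurable_funM => //; apply: (measurableT_comp mf); exact: measurable_funM.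
- by move=> x; rewrite mulr_ge0.
move=> A mA.
have mA' := measurable_preimage_affine a 0 mA.
transitivity (distribution P X ((fun x => a * x + 0) @^-1` A)).
  by rewrite /distribution /pushforward; congr (P _); apply/seteqP; split => w /=; rewrite addr0.
rewrite fX// (@ge0_integral_affine _ a^-1 0 _ (EFin \o f))//; last 2 first.
- by apply/measurable_EFinP; exact: measurable_funTS.
- by move=> x _; rewrite lee_fin.
rewrite (_ : _ @^-1` _ = A); last by apply/seteqP; split => x /=; rewrite !addr0 mulVKf.
rewrite -ge0_integralZl//=.
- by apply: eq_integral => x _; rewrite addr0 normfV.
- apply/measurable_EFinP; apply: measurable_funTS; apply: (measurableT_comp mf).
  exact: measurable_affine.
- by move=> x _; rewrite lee_fin.
Qed.

Lemma is_density_uniform (X : {RV P >-> R}) (a b : R) : uniformly_distributed P X a b ->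
  is_density P X (uniform_pdf a b).
Proof.
move=> [ab XU]; split.
- exact: measurable_uniform_pdf.
- by move=> x; exact: uniform_pdf_ge0.
- by move=> A mA; rewrite XU.
Qed.

Lemma is_density_add_uniform (Y Z : {RV P >-> R}) (a b : R) (g h : R -> R) :
  (forall D D', measurable D -> measurable D' ->
    P (Y @^-1` D `&` Z @^-1` D') = (P (Y @^-1` D) * P (Z @^-1` D'))%E) ->
  uniformly_distributed P Y a b -> is_density P Z g -> measurable_fun setT h ->
  (forall t, (h t)%:E = ((b - a)^-1)%:E * \int[mu]_(y in `[a, b]) (g (t - y)%R)%:E)%E ->
  is_density P (Y + Z) h.
Proof.
move=> YZ [ab YU] [mg g0 gZ] mh hE.
have h0 x : 0 <= h x.
  rewrite -lee_fin hE mule_ge0//; first by rewrite lee_fin invr_ge0 subr_ge0 ltW.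
  by apply: integral_ge0 => y _; rewrite lee_fin.
split => // A mA.
rewrite distribution_add//.
pose phi (y : R) := distribution P Z [set z | A (y + z)].
have mphi : measurable_fun setT phi by exact: measurable_distribution_shift.
transitivity (\int[distribution P Y]_y phi y)%E; first by rewrite ge0_integral_distribution.
(* Transports [uniform_prob ab] from [measurableTypeR R] to [R], which has another display. *)
have mid : measurable_fun setT (idfun : measurableTypeR R -> R) by exact: measurable_id.
pose Id : {mfun measurableTypeR R >-> R} := HB.pack_for {mfun measurableTypeR R >-> R}
  (idfun : measurableTypeR R -> R) (isMeasurableFun.Build _ _ (measurableTypeR R) R idfun mid).
transitivity (\int[distribution (uniform_prob ab) Id]_y phi y)%E.
  by apply: eq_measure_integral => B mB _; exact: YU.
rewrite ge0_integral_distribution//=.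
rewrite integral_uniform//.
transitivity (((b - a)^-1)%:E * \int[mu]_(y in `[a, b]) \int[mu]_(t in A) (g (t - y)%R)%:E)%E.
  congr (_ * _)%E; apply: eq_integral => y _.
  rewrite /phi gZ; last exact: measurable_shift.
  rewrite (@ge0_integral_affine _ 1 y A (fun t => (g (t - y))%:E)) ?oner_eq0//.
  - rewrite normr1 mul1e preimage_shift.
    by apply: eq_integral => t _; rewrite mul1r addrK.
  - apply/measurable_EFinP; apply: measurable_funTS; apply: (measurableT_comp mg).
    exact: measurable_funB.
  - by move=> t _; rewrite lee_fin.
have mI : measurable (`[a, b]%classic : set R) by exact: measurable_itv.
pose F (z : R * R) := (g (z.2 - z.1))%:E.
have mF : measurable_fun ((`[a, b]%classic : set R) `*` A) F.
  apply/measurable_EFinP; apply: measurable_funTS; apply: (measurableT_comp mg).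
  by apply: measurable_funB; [exact: measurable_snd|exact: measurable_fst].
have F0 (x y : R) : `[a, b]%classic x -> A y -> (0 <= F (x, y))%E by rewrite lee_fin.
have := @fubini_tonelli_on _ _ _ _ _ mu mu _ _ F mI mA mF F0.
rewrite /F/= => ->.
have ba0 : 0 < b - a by rewrite subr_gt0.
have hE' t : (\int[mu]_(y in `[a, b]) (g (t - y)%R)%:E = (b - a)%:E * (h t)%:E)%E.
  by rewrite hE muleA -EFinM divff ?mul1e// gt_eqF.
under eq_integral do rewrite hE'.
rewrite ge0_integralZl//=.
- by rewrite muleA -EFinM mulVf ?mul1e// gt_eqF.
- by apply/measurable_EFinP; exact: measurable_funTS.
- by move=> x _; rewrite lee_fin.
- by rewrite lee_fin ltW.
Qed.

(** The convolution of two uniform densities, [conv] below, rescaled by the inverse of [Num.sqrt 2];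
    its peak at 0 is the optimal constant. *)
Definition triangular (K x : R) : R := Num.sqrt 2 * K * Num.max 0 (1 - Num.sqrt 2 * K * `|x|).

Lemma continuous_triangular K : continuous (triangular K).
Proof.
rewrite (_ : triangular K = fun x => Num.sqrt 2 * K * ((0 + (1 - Num.sqrt 2 * K * `|x|) +
   `|0 - (1 - Num.sqrt 2 * K * `|x|)|) / 2)); last first.
  by apply/funext => x; rewrite /triangular maxr_absE.
move=> x; apply: cvgM; first exact: cvg_cst.
have c1 : (1 - Num.sqrt 2 * K * `|z|) @[z --> x] --> 1 - Num.sqrt 2 * K * `|x|.
  apply: cvgB; first exact: cvg_cst.
  by apply: cvgM; [exact: cvg_cst|exact: norm_continuous].
apply: cvgM; last exact: cvg_cst.
apply: cvgD; first by apply: cvgD => //; exact: cvg_cst.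
by apply: cvg_norm; apply: cvgB => //; exact: cvg_cst.
Qed.

Lemma is_density_triangular (X : 'I_2 -> {RV P >-> R}) (K : R) : 0 < K ->
  mutually_independent P X ->
  (forall j, uniformly_distributed P (X j) (- (2 * K)^-1) (2 * K)^-1) ->
  is_density P ((Num.sqrt 2)^-1 *: (X ord0 + X ord_max)) (triangular K).
Proof.
move=> K0 indX XU.
pose h := (2 * K)^-1; have h0 : 0 < h by rewrite invr_gt0 mulr_gt0.
pose conv (t : R) := K * Num.max 0 (1 - K * `|t|).
have s2 : 0 < Num.sqrt 2 :> R by rewrite sqrtr_gt0.
have dS : is_density P (X ord0 + X ord_max) conv.
  apply: (is_density_add_uniform _ (XU ord0) (is_density_uniform (XU ord_max))).
  - move=> D D' mD mD'.
    have := @mutually_independent_sum2 _ _ _ P _ X ord0 [:: ord_max] D D' indX isT mD mD'.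
    by rewrite !big_seq1.
  - apply: measurable_funM => //; apply: measurable_maxr => //.
    by apply: measurable_funB => //; apply: measurable_funM => //; exact: measurableT_comp.
  move=> t.
  have -> : ((2 * K)^-1 - - (2 * K)^-1)^-1 = K by field; rewrite gt_eqF.
  rewrite -/h.
  (* The overlap of two intervals of length [2 * h] centred at 0 and [t]. When nonempty its length
     is [2 * h] minus the absolute value of [t], and [K * h = 2^-1] turns this into the tent
     function. *)
  pose J : set R := `[(Num.max (- h) (t - h)), (Num.min h (t + h))]%classic.
  have JE : `[(t - h), (t + h)]%classic `&` `[(- h), h]%classic = J :> set R.
    apply/seteqP; split => y; rewrite /J /= !in_itv/= ge_max le_min.
      by move=> [/andP[-> ->] /andP[-> ->]].
    by move=> /andP[/andP[-> ->] /andP[-> ->]].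
  have -> : (\int[mu]_(y in `[(- h)%R, h]) (uniform_pdf (- h) h (t - y)%R)%:E = K%:E * mu J)%E.
    transitivity (\int[mu]_(y in `[(- h)%R, h]) (K%:E * (\1_(`[(t - h)%R, (t + h)%R]%classic) y)%:E))%E.
      apply: eq_integral => y _; rewrite -EFinM indicE mem_setE /uniform_pdf; congr EFin.
      have -> : (h - - h)^-1 = K by rewrite /h; field; rewrite gt_eqF.
      rewrite in_itv/= (_ : (- h <= t - y <= h) = (t - h <= y <= t + h)).
        by case: ifP; rewrite ?mulr1 ?mulr0.
      by rewrite lerBrDr lerBlDr andbC lerBlDr addrC [- h + y]addrC lerBlDr.
    rewrite ge0_integralZl//=.
    - rewrite integral_indic// ?JE//; exact: measurable_itv.
    - by apply/measurable_EFinP; apply: measurable_funTS; exact: measurable_indic.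
    - by rewrite lee_fin ltW.
  rewrite /J lebesgue_measure_itv/= lte_fin.
  have Kh : K * h = 2^-1 by rewrite /h; field; rewrite gt_eqF.
  have Kt (u : R) : K * (h - (u - h)) = 1 - K * u.
    by rewrite opprB addrA mulrBr mulrDr Kh; clear; lra.
  have pos : (K * Num.max 0 (1 - K * `|t|))%:E =
      (K%:E * (K%:E * (if (`|t| - h < h)%R then (h - (`|t| - h))%R%:E else 0)))%E.
    case: ltP => th.
      by rewrite -!EFinM Kt max_r// -Kt ltW// mulr_gt0// subr_gt0.
    by rewrite !mule0 max_l ?mulr0// -Kt mulr_ge0_le0 ?subr_le0// ltW.
  rewrite /conv pos; congr (_ * (_ * _))%E.
  have [t0|t0] := leP 0 t.
    rewrite (max_r (_ : - h <= t - h)) ?(min_l (_ : h <= t + h)) ?ger0_norm ?EFinB//; clear -t0; lra.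
  rewrite (max_l (_ : t - h <= - h)) ?(min_r (_ : t + h <= h)) ?ltr0_norm//; [|clear -t0; lra..].
  rewrite (_ : (- h < t + h) = (- t - h < h)); last by apply/idP/idP; clear; lra.
  by case: ifP => // _; rewrite -EFinB; congr EFin; clear; lra.
have := is_densityZ (invr_neq0 (lt0r_neq0 s2)) dS.
rewrite (_ : (fun x => _) = triangular K)//.
apply/funext => x; rewrite /conv /triangular invrK gtr0_norm ?invr_gt0// invrK.
rewrite normrM (gtr0_norm s2).
by rewrite mulrA [K * (_ * _)]mulrA [K * _]mulrC.
Qed.

(** A violation at one point would persist on a ball, which has positive measure. This turns the
    peak of one continuous version into a lower bound for every admissible [M]. *)
Lemma continuous_density_le (X : {RV P >-> R}) (f : R -> R) (M x : R) :
  is_density P X f -> continuous f -> density_bounded_by P X M -> f x <= M.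
Proof.
move=> fX cf [_ /(_ f fX)] [N [mN muN fN]].
rewrite leNgt; apply/negP => Mfx.
have : \forall y \near x, M < f y by exact: (@cvgr_gt _ _ _ _ f (f x) (cf x) M Mfx).
move=> /nbhs_ballP[e /= e0 eN].
have : (mu (ball x e) <= mu N)%E.
  apply: le_measure; rewrite ?inE//; first exact: measurable_ball.
  by move=> y /eN fy; apply: fN => /=; apply/negP; rewrite -ltNge.
rewrite muN (_ : mu (ball x e) = (e *+ 2)%:E); first by rewrite lee_fin leNgt mulrn_wgt0.
by rewrite lebesgue_measure_ball// ltW.
Qed.
End triangular_density.

Unset Implicit Arguments.

Theorem theorem1p2 (R : realType) (K : R) :
  (forall (d : measure_display) (T : measurableType d) (P : probability T R)
      (n : nat) (X : 'I_n -> {RV P >-> R}) (a : 'I_n -> R),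
    mutually_independent P X ->
    (forall j, density_bounded_by P (X j) K) ->
    \sum_(j < n) a j ^+ 2 = 1 ->
    density_bounded_by P (\sum_(j < n) a j *: X j)
      (Num.sqrt 2 * K))
  /\
  (0 < K ->
    (exists (d : measure_display) (T : measurableType d) (P : probability T R)
        (X : 'I_2 -> {RV P >-> R}),
      mutually_independent P X /\
      forall j, uniformly_distributed P (X j) (- (2 * K)^-1) (2 * K)^-1)
    /\
    (forall (d : measure_display) (T : measurableType d) (P : probability T R)
        (X : 'I_2 -> {RV P >-> R}),
      mutually_independent P X ->
      (forall j, uniformly_distributed P (X j) (- (2 * K)^-1) (2 * K)^-1) ->
      let S : {RV P >-> R} :=
        (Num.sqrt 2)^-1 *: (X ord0 + X ord_max) in
      (exists f : R -> R,
        [/\ is_density P S f, continuous f & exists x, f x = Num.sqrt 2 * K]) /\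
      (forall M : R, density_bounded_by P S M -> Num.sqrt 2 * K <= M))).
Proof.
split=> [d T P n X a indX XK a1|K0]; first exact: density_bounded_sum.
split=> [|d T P X indX XU S].
  by apply: uniform_pair_exists; rewrite gt0_cp// ?invr_gt0 ?mulr_gt0.
have dS : is_density P S (triangular K) by exact: is_density_triangular.
have t0 : triangular K 0 = Num.sqrt 2 * K.
  by rewrite /triangular normr0 mulr0 subr0 max_r// mulr1.
split; first by exists (triangular K); split=> //; [exact: continuous_triangular|exists 0].
move=> M SM; rewrite -t0.
exact: (continuous_density_le 0 dS (@continuous_triangular _ K) SM).
Qed.
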